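(* Let $\mathcal{E}$ be a smooth charted 2-vector bundle of rank $n$ over $M$, given over an ordered open cover $(\mathcal{U},\mathcal{J})$ by objects $E^{\alpha\beta}$ and coherency maps $\phi^{\alpha\beta\gamma}$, and let $c^{\alpha\beta\gamma\delta}:E^{\alpha\beta}\cdot(E^{\beta\gamma}\cdot E^{\gamma\delta})\to(E^{\alpha\beta}\cdot E^{\beta\gamma})\cdot E^{\gamma\delta}$ denote the associators. Then the signs $\operatorname{sgn}(c^{\alpha\beta\gamma\delta})$ define a 3-cocycle in the Čech complex $\check{C}^*(\mathcal{U},\{\pm1\})$. The class it represents in Čech cohomology depends only on the equivalence class of $\mathcal{E}$. Furthermore, this class is zero if and only if $\mathcal{E}$ is orientable.
   Context: Categories. $\mathcal{V}$ has objects $\mathbb{C}^n$ ($n\ge0$) and morphisms $\operatorname{Aut}(\mathbb{C}^n)=\mathrm{Gl}_n(\mathbb{C})$. It is bipermutative under block sum $\oplus$ and tensor product $\otimes$ (lexicographically ordered bases), with permutation matrices as coherence isomorphisms. $M_n(\mathcal{V})$ is the monoidal category of $n\times n$ matrices of objects (morphisms) of $\mathcal{V}$ with product $(E\cdot F)_{ik}=\bigoplus_jE_{ij}\otimes F_{jk}$. Its associator is, entrywise, the canonical coherence isomorphism of $\mathcal{V}$, and its unit is strict. Let $R=\mathbb{Z}\times\mathbb{C}^*$ be the commutative ring with addition $(n,a)\oplus(m,b)=(n+m,ab)$ and multiplication $(n,a)\otimes(m,b)=(nm,a^mb^n)$. For a morphism $\phi=(\phi_{ij})$ of $M_n(\mathcal{V})$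 on the object $(E_{ij})$, $\operatorname{Det}(\phi)\in R$ is the determinant over $R$ of the matrix with entries $(\dim E_{ij},\det\phi_{ij})$. $\mathrm{Gl}_n(\mathcal{V})\subset M_n(\mathcal{V})$ is the full monoidal subcategory of objects $E$ with $\det(\dim E_{ij})\in\{1,-1\}$. For an associator $c$ of $\mathrm{Gl}_n(\mathcal{V})$ one has $\operatorname{Det}(c)=(\pm1,s)$ with $s\in\{\pm1\}$; put $\operatorname{sgn}(c)=s$ (the same value for $c$ and $c^{-1}$). The oriented category $\mathrm{OGl}_n(\mathcal{V})$ has the same objects as $\mathrm{Gl}_n(\mathcal{V})$ and morphisms $(f,s)$ with $f$ a morphism of $\mathrm{Gl}_n(\mathcal{V})$ and $s\in\{\pm1\}$. Composition and monoidal product are those of $\mathrm{Gl}_n(\mathcal{V})$ on $f$ and multiplication on $s$; its associators are $(c,\operatorname{sgn}(c))$. The strict monoidal functor $P:\mathrm{OGl}_n(\mathcal{V})\to\mathrm{Gl}_n(\mathcal{V})$ forgets the sign. Bundles. $M$ is a smooth paracompact manifold with smooth partitions of unity. An ordered open cover $(\mathcal{U},\mathcal{J})$ is an open cover $\{U_\alpha\}_{\alpha\in\mathcal{J}}$ indexed by a partially ordered set $\mathcal{J}$ such that every finite set of indices with non-empty intersection $U_{\alpha_0\cdots\alpha_p}=U_{\alpha_0}\cap\dots\cap U_{\alpha_p}$ is totally ordered. For a smooth monoidal category $\mathcal{B}$ with discrete objects, a smooth principal $\mathcal{B}$-bundle over $M$ consists of an ordered open cover together with the following data. (1) For $\alpha<\beta$,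 objects $E^{\alpha\beta}$ of $\mathcal{B}$ with $E^{\alpha\beta}\cdot E^{\beta\gamma}=E^{\alpha\gamma}$ as objects for $\alpha<\beta<\gamma$. (2) For $\alpha<\beta<\gamma$, smooth coherency maps $\phi^{\alpha\beta\gamma}:U_{\alpha\beta\gamma}\to\operatorname{Mor}(E^{\alpha\beta}\cdot E^{\beta\gamma},E^{\alpha\gamma})$ (isomorphisms). (3) At every point of $U_{\alpha\beta\gamma\delta}$, $\alpha<\beta<\gamma<\delta$: $\phi^{\alpha\beta\delta}\circ(\mathrm{id}\cdot\phi^{\beta\gamma\delta})=\phi^{\alpha\gamma\delta}\circ(\phi^{\alpha\beta\gamma}\cdot\mathrm{id})\circ c^{\alpha\beta\gamma\delta}$, where $c^{\alpha\beta\gamma\delta}:E^{\alpha\beta}\cdot(E^{\beta\gamma}\cdot E^{\gamma\delta})\to(E^{\alpha\beta}\cdot E^{\beta\gamma})\cdot E^{\gamma\delta}$ is the associator. A smooth charted (oriented) 2-vector bundle of rank $n\in\mathbb{N}_0$ is a smooth principal $\mathrm{Gl}_n(\mathcal{V})$-bundle ($\mathrm{OGl}_n(\mathcal{V})$-bundle). Two such bundles $\mathcal{E}_0,\mathcal{E}_1$ over $M$ are equivalent if there is one over $M\times[0,1]$ restricting to $\mathcal{E}_t$ on $M\times\{t\}$, $t=0,1$. Here restriction restricts the cover and drops indices of sets with empty intersection, and the coherency maps are constant in the $[0,1]$-direction near the boundary. A smooth charted 2-vector bundle is orientable if it is equivalent to the image under $P$ of a smooth charted oriented 2-vector bundle.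 $\check{C}^*(\mathcal{U},\{\pm1\})$ is the Čech complex on ordered tuples $\alpha_0<\dots<\alpha_p$ with non-empty intersection, with coefficients in the constant group $\{\pm1\}$. Classes are considered in Čech cohomology $\check{H}^3(M;\{\pm1\})$ (colimit over refinements). *)

(* Defs.v *)
From HB Require Import structures.
From mathcomp Require Import all_boot all_order all_algebra all_fingroup.
From mathcomp Require Import character complex.
From mathcomp Require Import all_classical all_reals all_analysis.

Set Implicit Arguments.
Unset Strict Implicit.
Unset Printing Implicit Defensive.

Import Order.TTheory GRing.Theory Num.Theory.
Import numFieldNormedType.Exports.
Local Open Scope classical_set_scope.
Local Open Scope ring_scope.

(** * The ring Z x F^* *)

Definition nonzero (F : fieldType) := {x : F | x != 0}.

Section NonzeroGroup.
Variable F : fieldType.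
Implicit Types a b : nonzero F.

Definition nz1 : nonzero F := exist (fun x => is_true (x != 0)) 1 (oner_neq0 F).

Lemma nzmul_subproof a b : sval a * sval b != 0.
Proof. by case: a b => [a a0] [b b0]; rewrite mulf_neq0. Qed.
Definition nzmul a b : nonzero F :=
  exist (fun x => is_true (x != 0)) _ (nzmul_subproof a b).

Lemma nzexp_subproof a (m : int) : sval a ^ m != 0.
Proof. by case: a => a a0; rewrite expfz_neq0. Qed.
Definition nzexp a m : nonzero F :=
  exist (fun x => is_true (x != 0)) _ (nzexp_subproof a m).

Lemma nzE a b : sval a = sval b -> a = b.
Proof. exact: val_inj. Qed.

Lemma nz_neq0 a : sval a != 0. Proof. by case: a. Qed.

End NonzeroGroup.

Definition detring (F : fieldType) : Type := (int * nonzero F)%type.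

HB.instance Definition _ (F : fieldType) := Choice.on (detring F).

Section DetRing.
Variable F : fieldType.
Implicit Types x y z : detring F.

Definition dr_add x y : detring F := (x.1 + y.1, nzmul x.2 y.2).
Definition dr_opp x : detring F := (- x.1, nzexp x.2 (-1)).
Definition dr_mul x y : detring F :=
  (x.1 * y.1, nzmul (nzexp x.2 y.1) (nzexp y.2 x.1)).

Lemma dr_eq x y : x.1 = y.1 -> sval x.2 = sval y.2 -> x = y.
Proof. by case: x y => [n a] [m b] /= -> /nzE ->. Qed.

Lemma dr_addA : associative dr_add.
Proof. by move=> x y z; apply: dr_eq => /=; [rewrite addrA|rewrite mulrA]. Qed.
Lemma dr_addC : commutative dr_add.
Proof. by move=> x y; apply: dr_eq => /=; [rewrite addrC|rewrite mulrC]. Qed.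
Lemma dr_add0 : left_id (0, nz1 F) dr_add.
Proof. by move=> x; apply: dr_eq => /=; [rewrite add0r|rewrite mul1r]. Qed.
Lemma dr_addN : left_inverse (0, nz1 F) dr_opp dr_add.
Proof.
move=> x; apply: dr_eq => /=; first by rewrite addNr.
by rewrite exprN1 mulVf ?nz_neq0.
Qed.

HB.instance Definition _ :=
  GRing.isZmodule.Build (detring F) dr_addA dr_addC dr_add0 dr_addN.

Lemma dr_mulA : associative dr_mul.
Proof.
move=> x y z; apply: dr_eq => /=; first by rewrite mulrA.
by rewrite !expfzMl -!exprz_exp mulrA; congr (_ * _ * _);
   rewrite !exprz_exp; congr (_ ^ _); rewrite mulrC.
Qed.
Lemma dr_mulC : commutative dr_mul.
Proof. by move=> x y; apply: dr_eq => /=; rewrite mulrC. Qed.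
Lemma dr_mul1 : left_id (1, nz1 F) dr_mul.
Proof. by move=> x; apply: dr_eq => /=; rewrite ?mul1r// expr1z exp1rz mul1r. Qed.
Lemma dr_mulD : left_distributive dr_mul dr_add.
Proof.
move=> x y z; apply: dr_eq => /=; first by rewrite mulrDl.
by rewrite expfzMl expfzDr ?nz_neq0// mulrACA.
Qed.
Lemma dr_1neq0 : (1, nz1 F) != 0 :> detring F.
Proof. by apply/eqP => -[]. Qed.

HB.instance Definition _ := GRing.Zmodule_isComNzRing.Build (detring F)
  dr_mulA dr_mulC dr_mul1 dr_mulD dr_1neq0.

End DetRing.

(** * Kronecker products in coordinates *)

Section Kronecker.

Lemma index_pairs (T1 T2 : eqType) (s : seq T1) (t : seq T2) x y :
  x \in s -> y \in t ->
  index (x, y) [seq (a, b) | a <- s, b <- t] = (index x s * size t + index y t)%N.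
Proof.
move=> xs yt; elim: s xs => //= a s IH; rewrite inE index_cat => xas.
have [eax|nax] := eqVneq a x.
  by rewrite eax map_f // index_map // => u v [].
have -> : ((x, y) \in [seq (a, b) | b <- t]) = false.
  by apply/negbTE/mapP => -[b _ [exa _]]; rewrite exa eqxx in nax.
rewrite size_map IH ?mulSn ?addnA //.
by move: xas; rewrite eq_sym (negbTE nax).
Qed.

Lemma mxvec_index_val p q (a : 'I_p) (b : 'I_q) :
  mxvec_index a b = (a * q + b)%N :> nat.
Proof.
rewrite /mxvec_index /=.
have /(congr1 (index^~ (enum {: 'I_p * 'I_q}))) := nth_enum_rank (a, b) (a, b).
rewrite index_uniq ?enum_uniq -?cardE ?ltn_ord // => ->.
rewrite [enum _]enumT unlock /= /prod_enum index_pairs ?mem_enum //.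
by rewrite size_enum_ord !index_enum_ord.
Qed.

Variable F : fieldType.

Lemma trow_index n1 (A : 'rV[F]_n1) m2 n2 (B : 'M[F]_(m2, n2))
    (k : 'I_n1) (l : 'I_n2) (p : 'I_m2) (q : 'I_(n1 * n2)) :
  q = (k*n2+l)%N :> nat -> trow A B p q = A 0 k * B p l.
Proof.
elim: n1 A k q => [|n1 IH] A k q; first by case: k.
move=> eq /=; rewrite mxE; case: splitP => /= [q' eq'|q' eq'].
- have k0 : k = @lshift 1 n1 ord0.
    apply: val_inj => /=; have:= ltn_ord q'; rewrite -eq' eq.
    by case: (nat_of_ord k) => // k'; rewrite mulSn -addnA ltnNge leq_addr.
  by rewrite !mxE [in RHS]k0; congr (_ * B _ _); apply: val_inj; rewrite /= -eq' eq k0.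
- have k0 : (0 < k)%N.
    case: (posnP k) => // k0; move: eq; rewrite k0 mul0n eq' add0n => e.
    by have := ltn_ord l; rewrite -e ltnNge leq_addr.
  have k1 : (k.-1 < n1)%N by have := ltn_ord k; rewrite -(prednK k0) ltnS prednK.
  rewrite (IH _ (Ordinal k1)).
    rewrite mxE; congr (A _ _ * _); apply: val_inj => /=.
    by rewrite add1n prednK.
  by apply/eqP; rewrite /= -(eqn_add2l n2) -eq' eq addnA -mulSn prednK.
Qed.

Lemma tprod_index m1 n1 (A : 'M[F]_(m1,n1)) m2 n2 (B : 'M[F]_(m2,n2)) i k j l :
  tprod A B (mxvec_index i j) (mxvec_index k l) = A i k * B j l.
Proof.
have := mxvec_index_val i j; move: (mxvec_index i j).
elim: m1 A i => [|m1 IH] A i q; first by case: i.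
move=> eq /=; rewrite mxE; case: splitP => /= [q' eq'|q' eq'].
- have k0 : i = @lshift 1 m1 ord0.
    apply: val_inj => /=; have:= ltn_ord q'; rewrite -eq' eq.
    by case: (nat_of_ord i) => // k'; rewrite mulSn -addnA ltnNge leq_addr.
  rewrite (trow_index _ _ _ (mxvec_index_val k l)) !mxE [in RHS]k0.
  by congr (_ * B _ _); apply: val_inj; rewrite /= -eq' eq k0.
- have k0 : (0 < i)%N.
    case: (posnP i) => // k0; move: eq; rewrite k0 mul0n eq' add0n => e.
    by have := ltn_ord j; rewrite -e ltnNge leq_addr.
  have k1 : (i.-1 < m1)%N by have := ltn_ord i; rewrite -(prednK k0) ltnS prednK.
  rewrite (IH _ (Ordinal k1)).
    rewrite mxE; congr (A _ _ * _); apply: val_inj => /=.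
    by rewrite add1n prednK.
  by apply/eqP; rewrite /= -(eqn_add2l m2) -eq' eq addnA -mulSn prednK.
Qed.

End Kronecker.

(** * The bipermutative category V over a field *)

(* An object is a dimension.  Matrices act on column vectors; a morphism
   C^m -> C^n exists only for m = n, and is then an element of GL_n. *)
Record vmor (F : fieldType) (m n : nat) := VMor {
  vmx :> 'M[F]_(n, m);
  vmxP : row_free vmx && row_full vmx }.

Section CategoryV.
Variable F : fieldType.

Lemma vmor_inj m n : injective (@vmx F m n).
Proof. by case=> A pA [B pB] /= eAB; case: _ / eAB in pB *; congr VMor. Qed.

Lemma vmor_inverse m n (A : 'M[F]_(n, m)) :
  (exists2 B, B *m A = 1%:M & A *m B = 1%:M) -> row_free A && row_full A.
Proof.
by case=> B BA AB; apply/andP; split; [apply/row_freeP|apply/row_fullP]; exists B.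
Qed.

Lemma vmorP m n (A : vmor F m n) :
  exists2 B : 'M[F]_(m, n), B *m A = 1%:M & A *m B = 1%:M.
Proof.
have /andP[/row_freeP[B AB] /row_fullP[C CA]] := vmxP A.
by exists B => //; rewrite -[B]mul1mx -CA -(mulmxA C) AB mulmx1.
Qed.

Lemma vmor_dim m n : vmor F m n -> n = m.
Proof.
by move=> A; have /andP[/eqP rn /eqP rm] := vmxP A; exact: etrans (esym rn) rm.
Qed.

Lemma vid_subproof n : row_free (1%:M : 'M[F]_n) && row_full (1%:M : 'M[F]_n).
Proof. by apply: vmor_inverse; exists 1%:M; rewrite mulmx1. Qed.
Definition vid n : vmor F n n := VMor (vid_subproof n).

Lemma vcomp_subproof m n p (g : vmor F n p) (f : vmor F m n) :
  row_free (g *m f) && row_full (g *m f).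
Proof.
have [g' g'g gg'] := vmorP g; have [f' f'f ff'] := vmorP f.
apply: vmor_inverse; exists (f' *m g').
  by rewrite mulmxA -(mulmxA f') g'g mulmx1.
by rewrite mulmxA -(mulmxA g) ff' mulmx1.
Qed.
Definition vcomp m n p (g : vmor F n p) (f : vmor F m n) : vmor F m p :=
  VMor (vcomp_subproof g f).

(* [tprod] is the Kronecker product for lexicographically ordered bases. *)
Lemma vtens_subproof m n m' n' (f : vmor F m n) (g : vmor F m' n') :
  row_free (tprod f g) && row_full (tprod f g).
Proof.
have [f' f'f ff'] := vmorP f; have [g' g'g gg'] := vmorP g.
by apply: vmor_inverse; exists (tprod f' g');
  rewrite -tprodE ?f'f ?g'g ?ff' ?gg' tprod1.
Qed.
Definition vtens m n m' n' (f : vmor F m n) (g : vmor F m' n') :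
  vmor F (m * m') (n * n') := VMor (vtens_subproof f g).

(* The analogue of [mxdiag] for blocks whose two dimensions are equal only
   propositionally. *)
Definition blockdiag r (p q : 'I_r -> nat) (A : forall j, 'M[F]_(q j, p j)) :
    'M[F]_((\sum_j q j)%N, (\sum_j p j)%N) :=
  \mxblock_(j, k) (if j == k then conform_mx 0 (A j) else 0).

Lemma blockdiag_mul r (p q s : 'I_r -> nat) (A : forall j, 'M[F]_(q j, p j))
    (B : forall j, 'M[F]_(s j, q j)) :
  blockdiag B *m blockdiag A = blockdiag (fun j => B j *m A j).
Proof.
rewrite mul_mxblock; apply: eq_mxblock => i k.
rewrite (bigD1 i)//= eqxx conform_mx_id big1 ?addr0 => [|j]; last first.
  by rewrite eq_sym => /negbTE->; rewrite mul0mx.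
case: eqP => [<-|_]; last by rewrite mulmx0.
by rewrite !conform_mx_id.
Qed.

Lemma blockdiag1 r (p : 'I_r -> nat) :
  blockdiag (fun j => 1%:M : 'M[F]_(p j)) = 1%:M.
Proof. exact: mxdiagZ. Qed.

Lemma vsum_subproof r (p q : 'I_r -> nat) (f : forall j, vmor F (p j) (q j)) :
  row_free (blockdiag f) && row_full (blockdiag f).
Proof.
have [g gP] : exists g : forall j, 'M[F]_(p j, q j),
    forall j, g j *m f j = 1%:M /\ f j *m g j = 1%:M.
  have h j : {B : 'M[F]_(p j, q j) | (B *m f j = 1%:M) /\ (f j *m B = 1%:M)}.
    by apply: cid; have [B] := vmorP (f j); exists B.
  by exists (fun j => sval (h j)) => j; case: (h j).
apply: vmor_inverse; exists (blockdiag g); rewrite blockdiag_mul -blockdiag1;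
  by congr blockdiag; apply: functional_extensionality_dep => j; case: (gP j).
Qed.
Definition vsum r (p q : 'I_r -> nat) (f : forall j, vmor F (p j) (q j)) :
  vmor F (\sum_j p j)%N (\sum_j q j)%N := VMor (vsum_subproof f).

Definition vdet m n (f : vmor F m n) : F :=
  \det (castmx (erefl n, esym (vmor_dim f)) (vmx f)).

Lemma vdet_neq0 m n (f : vmor F m n) : vdet f != 0.
Proof.
rewrite /vdet; move: (vmor_dim f) => e; case: _ / e in f *.
by have /andP[] := vmxP f; rewrite castmx_id row_free_unit unitmxE unitfE.
Qed.

End CategoryV.

(** * The monoidal category M_n(V) *)

Definition dims n := 'I_n -> 'I_n -> nat.

Section MatrixCategory.
Variables (F : fieldType) (n : nat).
Implicit Types X Y Z : dims n.

Definition mhom X Y := forall i j, vmor F (X i j) (Y i j).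

Definition mid X : mhom X X := fun i j => vid F (X i j).
Definition mcomp X Y Z (g : mhom Y Z) (f : mhom X Y) : mhom X Z :=
  fun i j => vcomp (g i j) (f i j).

Definition mprod X Y : dims n := fun i k => (\sum_j X i j * Y j k)%N.
Definition mprodm X X' Y Y' (f : mhom X X') (g : mhom Y Y') :
    mhom (mprod X Y) (mprod X' Y') :=
  fun i k => vsum (fun j => vtens (f i j) (g j k)).

Section Associator.
Variables (X Y Z : dims n) (i l : 'I_n).

(* [Tagged _ (a, b, c)] with tag [(j, k)] stands for the basis vector
   e_a (x) e_b (x) e_c of the summand X_ij (x) Y_jk (x) Z_kl. *)
Definition basis3 : finType :=
  {jk : 'I_n * 'I_n & 'I_(X i jk.1) * 'I_(Y jk.1 jk.2) * 'I_(Z jk.2 l)}%type.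

Definition basis_right (u : basis3) : 'I_(mprod X (mprod Y Z) i l) :=
  tagnat.Rank (p_ := fun j => X i j * mprod Y Z j l)%N (tag u).1
    (mxvec_index (tagged u).1.1
      (tagnat.Rank (p_ := fun k => Y (tag u).1 k * Z k l)%N (tag u).2
        (mxvec_index (tagged u).1.2 (tagged u).2))).

Definition basis_left (u : basis3) : 'I_(mprod (mprod X Y) Z i l) :=
  tagnat.Rank (p_ := fun k => mprod X Y i k * Z k l)%N (tag u).2
    (mxvec_index
      (tagnat.Rank (p_ := fun j => X i j * Y j (tag u).2)%N (tag u).1
        (mxvec_index (tagged u).1.1 (tagged u).1.2))
      (tagged u).2).

Definition assoc_mx :
    'M[F]_(mprod (mprod X Y) Z i l, mprod X (mprod Y Z) i l) :=
  \sum_(u : basis3) delta_mx (basis_left u) (basis_right u).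

Lemma mxvec_index_inj p q (a a' : 'I_p) (b b' : 'I_q) :
  mxvec_index a b = mxvec_index a' b' -> a = a' /\ b = b'.
Proof. by move=> /cast_ord_inj /enum_rank_inj[-> ->]. Qed.

Lemma Rank_inj r (p : 'I_r -> nat) (j j' : 'I_r) (a : 'I_(p j)) (a' : 'I_(p j')) :
  tagnat.Rank j a = tagnat.Rank j' a' ->
  Tagged (fun j => 'I_(p j)) a = Tagged (fun j => 'I_(p j)) a'.
Proof. exact: tagnat.rank_inj. Qed.

Lemma basis_right_inj : injective basis_right.
Proof.
move=> [[j k] [[a b] c]] [[j' k'] [[a' b'] c']]; rewrite /basis_right /= => /Rank_inj e.
have /= jj' := congr1 tag e; case: _ / jj' in a' b' e *.
move: e => /eqP; rewrite eq_Tagged => /eqP /= /mxvec_index_inj[<- /Rank_inj e].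
have /= kk' := congr1 tag e; case: _ / kk' in b' c' e *.
by move: e => /eqP; rewrite eq_Tagged => /eqP /= /mxvec_index_inj[<- <-].
Qed.

Lemma basis_left_inj : injective basis_left.
Proof.
move=> [[j k] [[a b] c]] [[j' k'] [[a' b'] c']]; rewrite /basis_left /= => /Rank_inj e.
have /= kk' := congr1 tag e; case: _ / kk' in b' c' e *.
move: e => /eqP; rewrite eq_Tagged => /eqP /= /mxvec_index_inj[/Rank_inj e <-].
have /= jj' := congr1 tag e; case: _ / jj' in a' b' e *.
by move: e => /eqP; rewrite eq_Tagged => /eqP /= /mxvec_index_inj[<- <-].
Qed.

Lemma mxvec_index_surj p q (s : 'I_(p * q)) :
  exists (a : 'I_p) (b : 'I_q), mxvec_index a b = s.
Proof. by case/mxvec_indexP: s => a b; exists a, b. Qed.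

Lemma Rank_surj r (p : 'I_r -> nat) (s : 'I_(\sum_i p i)%N) :
  exists (j : 'I_r) (a : 'I_(p j)), tagnat.Rank j a = s.
Proof. by exists (tagnat.sig1 s), (tagnat.sig2 s); rewrite tagnat.sig2K. Qed.

Lemma basis_right_surj s : exists u, basis_right u = s.
Proof.
have [j [x <-]] := Rank_surj s; have [a [{}x <-]] := mxvec_index_surj x.
have [k [{}x <-]] := Rank_surj x; have [b [c <-]] := mxvec_index_surj x.
by exists (Tagged (fun jk : 'I_n * 'I_n =>
  ('I_(X i jk.1) * 'I_(Y jk.1 jk.2) * 'I_(Z jk.2 l))%type) (i := (j, k)) (a, b, c)).
Qed.

Lemma basis_left_surj s : exists u, basis_left u = s.
Proof.
have [k [x <-]] := Rank_surj s; have [{}x [c <-]] := mxvec_index_surj x.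
have [j [{}x <-]] := Rank_surj x; have [a [b <-]] := mxvec_index_surj x.
by exists (Tagged (fun jk : 'I_n * 'I_n =>
  ('I_(X i jk.1) * 'I_(Y jk.1 jk.2) * 'I_(Z jk.2 l))%type) (i := (j, k)) (a, b, c)).
Qed.

Lemma sum_delta_mx N (s : basis3 -> 'I_N) :
  injective s -> (forall p, exists u, s u = p) ->
  \sum_u delta_mx (s u) (s u) = 1%:M :> 'M[F]_N.
Proof.
move=> s_inj s_surj; apply/matrixP => p q; rewrite summxE mxE.
have [u <-] := s_surj p.
rewrite (bigD1 u)//= big1 ?addr0 => [|v vu]; last first.
  by rewrite mxE (inj_eq s_inj) eq_sym (negbTE vu).
by rewrite mxE eqxx [q == _]eq_sym.
Qed.

Lemma mul_sum_delta_mx m N p (s : basis3 -> 'I_m) (t : basis3 -> 'I_N)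
    (w : basis3 -> 'I_p) : injective t ->
  (\sum_u delta_mx (s u) (t u)) *m (\sum_u delta_mx (t u) (w u)) =
  \sum_u delta_mx (s u) (w u) :> 'M[F]_(m, p).
Proof.
move=> t_inj; rewrite mulmx_suml; apply: eq_bigr => u _.
rewrite mulmx_sumr (bigD1 u)//= mul_delta_mx big1 ?addr0 // => v vu.
by rewrite mul_delta_mx_0// (inj_eq t_inj) eq_sym.
Qed.

Lemma massoc_subproof : row_free assoc_mx && row_full assoc_mx.
Proof.
apply: vmor_inverse; exists (\sum_u delta_mx (basis_right u) (basis_left u)).
- rewrite mul_sum_delta_mx; last exact: basis_left_inj.
  by apply: sum_delta_mx; [exact: basis_right_inj|exact: basis_right_surj].
- rewrite mul_sum_delta_mx; last exact: basis_right_inj.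
  by apply: sum_delta_mx; [exact: basis_left_inj|exact: basis_left_surj].
Qed.

End Associator.

Definition massoc X Y Z :
    mhom (mprod X (mprod Y Z)) (mprod (mprod X Y) Z) :=
  fun i l => VMor (massoc_subproof X Y Z i l).

Definition Det X Y (f : mhom X Y) : detring F :=
  \det (\matrix_(i, j)
    ((X i j : int), exist (fun x => is_true (x != 0)) _ (vdet_neq0 (f i j))) :
      'M[detring F]_n).

(* Signs are represented by booleans, [b] standing for (-1) ^+ b; the group
   law is [addb]. *)
Definition sgn X Y Z : bool := sval (Det (massoc X Y Z)).2 == -1.

Lemma assoc_mx_det X Y Z i l :
  vdet (massoc X Y Z i l) = 1 \/ vdet (massoc X Y Z i l) = -1.
Proof.
rewrite /vdet; move: (vmor_dim _) => e.
set c := vmx _; have cc : c *m c^T = 1%:M.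
  rewrite /c /= /assoc_mx.
  rewrite [X in _ *m X]linear_sum
    (eq_bigr _ (fun u _ => trmx_delta F (basis_left u) (basis_right u))).
  rewrite mul_sum_delta_mx; last exact: basis_right_inj.
  by apply: sum_delta_mx; [exact: basis_left_inj|exact: basis_left_surj].
clearbody c; move: c cc; case: _ / (e) => c; rewrite castmx_id => cc.
have : (\det c) ^+ 2 = 1 by rewrite expr2 -{2}det_tr -det_mulmx cc det1.
by move/eqP; rewrite sqrf_eq1 => /orP[] /eqP ->; [left|right].
Qed.

Lemma sgn_spec X Y Z :
  sval (Det (massoc X Y Z)).2 = (-1) ^+ sgn X Y Z.
Proof.
suff [e|e] : sval (Det (massoc X Y Z)).2 = 1 \/ sval (Det (massoc X Y Z)).2 = -1.
- rewrite /sgn e; have [e'|//] := eqVneq (1 : F) (-1). by rewrite expr1.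
- by rewrite /sgn e eqxx.
pose P (x : detring F) := sval x.2 = 1 \/ sval x.2 = -1.
have PX a (m : int) : (a : F) = 1 \/ a = -1 -> a ^ m = 1 \/ a ^ m = -1.
  move=> [] ->; first by left; rewrite exp1rz.
  case: m => m; rewrite /exprz ?NegzE;
    rewrite -signr_odd; case: odd => /=;
    rewrite ?invrN ?invr1 ?expr0 ?expr1 ?invr1 ?invrN ?invr1; auto.
have PM x y : P x -> P y -> P (x * y).
  rewrite /P /= => /(PX _ y.1) [] -> /(PX _ x.1) [] ->;
    rewrite ?mul1r ?mulr1 ?mulrNN ?mulr1; auto.
have PA x y : P x -> P y -> P (x + y).
  rewrite /P /=; case=> ->; case=> ->; rewrite ?mul1r ?mulr1 ?mulrNN ?mulr1; auto.
have P0 : P 0 by left. have P1 : P 1 by left.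
have PN x : P x -> P (- x) by move=> Px; exact: (PX _ (-1)).
rewrite /Det; apply: (big_ind P P0 PA) => s _.
have PS : P ((-1) ^+ odd_perm s) by case: odd_perm; rewrite ?expr0 ?expr1 //; exact: PN.
apply: (PM _ _ PS).
apply: (big_ind P P1 PM) => i _; rewrite mxE /P /=; exact: assoc_mx_det.
Qed.

End MatrixCategory.

(** * Monoidal categories with discrete objects, Gl_n(V) and OGl_n(V) *)

(* The smooth structure on a morphism space is given by real coordinate
   functions: a map into [hom X Y] is smooth when all its coordinates are.
   Only the data entering the definition of a bundle are recorded. *)
Record moncat (R : realType) := MonCat {
  ob : Type;
  hom : ob -> ob -> Type;
  idm : forall X, hom X X;
  comp : forall X Y Z, hom Y Z -> hom X Y -> hom X Z;
  prodo : ob -> ob -> ob;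
  prodm : forall X X' Y Y', hom X X' -> hom Y Y' -> hom (prodo X Y) (prodo X' Y');
  assoc : forall X Y Z, hom (prodo X (prodo Y Z)) (prodo (prodo X Y) Z);
  coords : forall X Y, set (hom X Y -> R) }.

Arguments idm {R B} X : rename.
Arguments comp {R B X Y Z} : rename.
Arguments prodo {R B} : rename.
Arguments prodm {R B X X' Y Y'} : rename.
Arguments assoc {R B} X Y Z : rename.
Arguments coords {R B X Y} : rename.

Definition is_iso (R : realType) (B : moncat R) (X Y : ob B) (f : hom X Y) :=
  exists2 g : hom Y X, comp g f = idm X & comp f g = idm Y.

(* Equality of [arrow f] and [arrow g] is equality of morphisms together with
   their sources and targets. *)
Definition arrow (R : realType) (B : moncat R) (X Y : ob B) (f : hom X Y) :
    {XY : ob B * ob B & hom XY.1 XY.2} :=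
  existT (fun XY : ob B * ob B => hom XY.1 XY.2) (X, Y) f.

Definition dims_det n (X : dims n) : int := \det (\matrix_(i, j) (X i j : int)).

Record glob n := GlOb {
  gldims :> dims n;
  globP : (dims_det gldims == 1) || (dims_det gldims == -1) }.

Lemma glprod_subproof n (X Y : glob n) :
  (dims_det (mprod X Y) == 1) || (dims_det (mprod X Y) == -1).
Proof.
have -> : dims_det (mprod X Y) = dims_det X * dims_det Y.
  rewrite /dims_det -det_mulmx; congr (\det _); apply/matrixP => i k.
  rewrite !mxE /mprod -[LHS]natz natr_sum; apply: eq_bigr => j _.
  by rewrite !mxE natz PoszM.
by case/orP: (globP X) => /eqP ->; case/orP: (globP Y) => /eqP ->.
Qed.
Definition glprod n (X Y : glob n) : glob n := GlOb (glprod_subproof X Y).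

Section GL.
Variables (R : realType) (n : nat).

Definition gl_coords (X Y : glob n) : set (mhom R[i] X Y -> R) :=
  [set p | exists i j a b, p = (fun f => complex.Re (vmx (f i j) a b)) \/
                           p = (fun f => complex.Im (vmx (f i j) a b))].

Definition GL : moncat R := {|
  ob := glob n;
  hom := fun X Y : glob n => mhom R[i] X Y;
  idm := fun X : glob n => mid R[i] X;
  comp := fun (X Y Z : glob n) (g : mhom R[i] Y Z) (f : mhom R[i] X Y) => mcomp g f;
  prodo := @glprod n;
  prodm := fun (X X' Y Y' : glob n) (f : mhom R[i] X X') (g : mhom R[i] Y Y') =>
    mprodm f g;
  assoc := fun X Y Z : glob n => massoc R[i] X Y Z;
  coords := gl_coords |}.

Definition OGL : moncat R := {|
  ob := glob n;
  hom := fun X Y : glob n => (mhom R[i] X Y * bool)%type;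
  idm := fun X : glob n => (mid R[i] X, false);
  comp := fun (X Y Z : glob n) (g : mhom R[i] Y Z * bool) (f : mhom R[i] X Y * bool) =>
    (mcomp g.1 f.1, g.2 (+) f.2);
  prodo := @glprod n;
  prodm := fun (X X' Y Y' : glob n) (f : mhom R[i] X X' * bool)
      (g : mhom R[i] Y Y' * bool) =>
    (mprodm f.1 g.1, f.2 (+) g.2);
  assoc := fun X Y Z : glob n => (massoc R[i] X Y Z, sgn R[i] X Y Z);
  coords := fun X Y : glob n => [set p : mhom R[i] X Y * bool -> R |
    (exists2 q, gl_coords q & p = q \o fst) \/
    p = (fun f => (-1) ^+ f.2)] |}.

End GL.

(** * Smooth manifolds *)

(* C^k maps on an open subset of a normed space, in terms of iterated
   directional derivatives that are jointly continuous in the point and the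
   directions; for k = oo this is Frechet smoothness, and it does not require
   finite dimension. *)
Fixpoint Ck (R : realType) (k : nat) (E F : normedModType R) (U : set E)
    (f : E -> F) {struct k} : Prop :=
  (forall x, U x -> {for x, continuous f}) /\
  if k is k'.+1 then
    (forall x v, U x -> derivable f x v) /\
    @Ck R k' (E * E)%type F (U `*` setT) (fun p => 'D_(p.2) f p.1)
  else True.

Definition Coo (R : realType) (E F : normedModType R) (U : set E) (f : E -> F) :=
  forall k, Ck k U f.

(* [chart i] is meaningful on [dom i]. *)
Record atlas (R : realType) (M : topologicalType) (V : normedModType R) := Atlas {
  chart_idx : Type;
  dom : chart_idx -> set M;
  chart : chart_idx -> M -> V }.

Arguments dom {R M V} A i : rename.
Arguments chart {R M V} A i : rename.

Section Manifold.
Variables (R : realType) (M : topologicalType) (V : normedModType R).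
Variable A : atlas M V.

Definition smooth_atlas : Prop :=
  [/\ forall i, open (dom A i),
      forall x : M, exists i, dom A i x,
      forall i, {in dom A i &, injective (chart A i)},
      forall i x, dom A i x -> {for x, continuous (chart A i)} &
      forall i (O : set M), open O -> O `<=` dom A i -> open (chart A i @` O)] /\
  forall i j, exists2 h : V -> V,
    Coo (chart A i @` (dom A i `&` dom A j)) h &
    forall x, dom A i x -> dom A j x -> h (chart A i x) = chart A j x.

Definition smooth_on_open (O : set M) (g : M -> R) : Prop :=
  forall i, exists2 h : V -> R^o,
    Coo (chart A i @` (O `&` dom A i)) h &
    forall x, O x -> dom A i x -> g x = h (chart A i x).

(* Smoothness on a not necessarily open subset: local extendability to smooth
   functions on open sets. *)
Definition smooth_on (W : set M) (f : M -> R) : Prop :=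
  forall x, W x -> exists (O : set M) (g : M -> R),
    [/\ open O, O x, smooth_on_open O g & {in O `&` W, f =1 g}].

Definition locally_finite (I : Type) (S : I -> set M) : Prop :=
  forall x : M, exists2 N, nbhs x N & finite_set [set i | N `&` S i !=set0].

Definition open_cover (I : Type) (O : I -> set M) : Prop :=
  (forall i, open (O i)) /\ \bigcup_i O i = setT.

Definition paracompact : Prop :=
  forall (I : Type) (O : I -> set M), open_cover O ->
  exists (J : Type) (P : J -> set M),
    [/\ open_cover P, locally_finite P & forall j, exists i, P j `<=` O i].

Definition smooth_partitions_of_unity : Prop :=
  forall (I : choiceType) (O : I -> set M), open_cover O ->
  exists rho : I -> M -> R,
    [/\ forall i, smooth_on setT (rho i),
        forall i x, 0 <= rho i x,
        forall i, closure [set x | rho i x != 0] `<=` O i,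
        locally_finite (fun i => closure [set x | rho i x != 0]) &
        forall x, \sum_(i \in [set: I]) rho i x = 1].

Definition smooth_manifold : Prop :=
  [/\ smooth_atlas, hausdorff_space M, paracompact & smooth_partitions_of_unity].

(* The product of M with the real line; M x [0, 1] is treated as a subset of
   it. *)
Definition cyl_atlas : atlas (M * R)%type (V * R^o)%type := {|
  chart_idx := chart_idx A;
  dom := fun i => dom A i `*` setT;
  chart := fun i p => (chart A i p.1, p.2) |}.

Definition cylinder : set (M * R) := setT `*` `[0, 1].

End Manifold.

Arguments cylinder R M : clear implicits.

(** * Ordered open covers and principal bundles *)

(* Ordered covers of a subset [S] of [M] by subsets open in [S]. *)
Record ordered_cover (M : topologicalType) (S : set M) := OrderedCover {
  cdisp : Order.disp_t;
  idx : porderType cdisp;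
  cset :> idx -> set M;
  cset_open : forall a, exists2 O, open O & cset a = O `&` S;
  cset_cover : \bigcup_a cset a = S;
  cset_total : forall s : seq idx, \bigcap_(a in [set` s]) cset a !=set0 ->
    {in s &, forall a b, (a >=< b)%O} }.

Section Bundle.
Variables (R : realType) (B : moncat R).
Variables (M : topologicalType) (V : normedModType R) (A : atlas M V) (S : set M).

(* The values [bobj a b] are meaningful for a < b, and [bcoh ab bc x] for x in
   the triple intersection. *)
Record bundle := Bundle {
  bcover :> ordered_cover S;
  bobj : idx bcover -> idx bcover -> ob B;
  bobj_prod : forall a b c : idx bcover, (a < b)%O -> (b < c)%O ->
    prodo (bobj a b) (bobj b c) = bobj a c;
  bcoh : forall a b c : idx bcover, (a < b)%O -> (b < c)%O ->
    M -> hom (prodo (bobj a b) (bobj b c)) (bobj a c);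
  bcoh_smooth : forall (a b c : idx bcover) (ab : (a < b)%O) (bc : (b < c)%O) p,
    coords p ->
    smooth_on A (bcover a `&` bcover b `&` bcover c) (p \o bcoh ab bc);
  bcoh_iso : forall (a b c : idx bcover) (ab : (a < b)%O) (bc : (b < c)%O) x,
    (bcover a `&` bcover b `&` bcover c) x -> is_iso (bcoh ab bc x);
  bcoh_assoc : forall (a b c d : idx bcover)
      (ab : (a < b)%O) (bc : (b < c)%O) (cd : (c < d)%O)
      (ac : (a < c)%O) (bd : (b < d)%O) x,
    (bcover a `&` bcover b `&` bcover c `&` bcover d) x ->
    comp (bcoh ab bd x) (prodm (idm (bobj a b)) (bcoh bc cd x)) =
    comp (comp (bcoh ac cd x) (prodm (bcoh ab bc x) (idm (bobj c d))))
      (assoc (bobj a b) (bobj b c) (bobj c d)) }.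

End Bundle.

Arguments bobj {R B M V A S} E a b : rename.
Arguments bcoh {R B M V A S} E {a b c} ab bc x : rename.

(** * Equivalence and orientability *)

Section Equivalence.
Variables (R : realType) (B : moncat R).
Variables (M : topologicalType) (V : normedModType R) (A : atlas M V).

Definition nonempty_idx (I T : Type) (U : I -> set T) := {a : I | U a !=set0}.

Definition slice (W : set (M * R)) (t : R) : set M := [set x | W (x, t)].

(* The restriction of [H] to M x {t} is [E]; on both sides, indices of empty
   sets are dropped and the remaining ones are matched by an order
   isomorphism. *)
Definition restricts_to (H : bundle B (cyl_atlas A) (cylinder R M)) (t : R)
    (E : bundle B A setT) : Prop :=
  exists f : nonempty_idx E -> nonempty_idx (fun a => slice (H a) t),
    [/\ bijective f,
        forall a b : nonempty_idx E, (sval (f a) < sval (f b))%O = (sval a < sval b)%O,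
        forall a : nonempty_idx E, slice (H (sval (f a))) t = E (sval a),
        forall a b : nonempty_idx E, (sval a < sval b)%O ->
          bobj H (sval (f a)) (sval (f b)) = bobj E (sval a) (sval b) &
        forall (a b c : nonempty_idx E)
          (ab : (sval a < sval b)%O) (bc : (sval b < sval c)%O)
          (ab' : (sval (f a) < sval (f b))%O) (bc' : (sval (f b) < sval (f c))%O) x,
          (E (sval a) `&` E (sval b) `&` E (sval c)) x ->
          arrow (bcoh H ab' bc' (x, t)) = arrow (bcoh E ab bc x)].

Definition constant_near (H : bundle B (cyl_atlas A) (cylinder R M)) (t : R) : Prop :=
  forall (a b c : idx H) (ab : (a < b)%O) (bc : (b < c)%O) x,
    (H a `&` H b `&` H c) (x, t) ->
    \forall p \near ((x, t) : M * R), (H a `&` H b `&` H c) p ->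
      bcoh H ab bc p = bcoh H ab bc (p.1, t).

Definition equivalent (E0 E1 : bundle B A setT) : Prop :=
  exists H : bundle B (cyl_atlas A) (cylinder R M),
    [/\ restricts_to H 0 E0, restricts_to H 1 E1,
        constant_near H 0 & constant_near H 1].

End Equivalence.

Section Orientation.
Variables (R : realType) (n : nat).
Variables (M : topologicalType) (V : normedModType R) (A : atlas M V).

Definition bundle2 := bundle (GL R n) A setT.
Definition oriented_bundle2 := bundle (OGL R n) A setT.

Section Forget.
Variable O : oriented_bundle2.

Definition forget_coh (a b c : idx O) (ab : (a < b)%O) (bc : (b < c)%O) (x : M) :
    @hom R (GL R n) (prodo (bobj O a b) (bobj O b c)) (bobj O a c) :=
  (bcoh O ab bc x).1.

Lemma forget_smooth (a b c : idx O) (ab : (a < b)%O) (bc : (b < c)%O) p :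
  coords p -> smooth_on A (O a `&` O b `&` O c) (p \o forget_coh ab bc).
Proof. by move=> cp; apply: (bcoh_smooth ab bc (p := p \o fst)); left; exists p. Qed.

Lemma forget_iso (a b c : idx O) (ab : (a < b)%O) (bc : (b < c)%O) x :
  (O a `&` O b `&` O c) x -> is_iso (forget_coh ab bc x).
Proof.
by move=> /(bcoh_iso ab bc)[g /(congr1 fst) gf /(congr1 fst) fg]; exists g.1.
Qed.

Lemma forget_assoc (a b c d : idx O)
    (ab : (a < b)%O) (bc : (b < c)%O) (cd : (c < d)%O)
    (ac : (a < c)%O) (bd : (b < d)%O) x :
  (O a `&` O b `&` O c `&` O d) x ->
  comp (forget_coh ab bd x)
    (prodm (idm (B := GL R n) (bobj O a b)) (forget_coh bc cd x)) =
  comp (comp (forget_coh ac cd x)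
      (prodm (forget_coh ab bc x) (idm (B := GL R n) (bobj O c d))))
    (assoc (B := GL R n) (bobj O a b) (bobj O b c) (bobj O c d)).
Proof. by move=> /(bcoh_assoc ab bc cd ac bd) /(congr1 fst). Qed.

(* The image of an oriented bundle under the functor OGL -> GL that forgets the
   sign. *)
Definition forget : bundle2 :=
  @Bundle R (GL R n) M V A setT O (bobj O) (@bobj_prod _ _ _ _ _ _ O) forget_coh
    forget_smooth forget_iso forget_assoc.

End Forget.

Definition orientable (E : bundle2) : Prop :=
  exists O : oriented_bundle2, equivalent E (forget O).

End Orientation.

(** * Cech cohomology with coefficients in the group of signs *)

Section Cech.
Variables (M : topologicalType) (S : set M).

(* Only the values on [simplex] tuples are meaningful. *)
Definition cochain (J : Type) (p : nat) := ('I_p.+1 -> J) -> bool.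

Definition increasing d (J : porderType d) p (a : 'I_p -> J) : bool :=
  [forall i : 'I_p, forall j : 'I_p, (i < j)%N ==> (a i < a j)%O].

Definition simplex (U : ordered_cover S) p (a : 'I_p.+1 -> idx U) : Prop :=
  increasing a /\ \bigcap_i U (a i) !=set0.

Definition coboundary (J : Type) p (f : cochain J p) : cochain J p.+1 :=
  fun a => \big[addb/false]_(k < p.+2) f (a \o lift k).

Definition cocycle (U : ordered_cover S) p (f : cochain (idx U) p) : Prop :=
  forall a, simplex a -> coboundary f a = false.

(* The alternating extension of a cochain to arbitrary tuples of indices with
   common intersection; sign coefficients are insensitive to reordering. *)
Definition alternating d (J : porderType d) p (f : cochain J p) : cochain J p :=
  fun a => if [pick s : 'S_p.+1 | increasing (a \o s)] is Some s then f (a \o s)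
           else false.

Definition pullback d (J : porderType d) (K : Type) (r : K -> J) p (f : cochain J p) :
    cochain K p :=
  fun a => alternating f (r \o a).

Definition refinement (W U : ordered_cover S) (r : idx W -> idx U) : Prop :=
  forall a, W a `<=` U (r a).

(* Equality, in the colimit over all refinements, of the classes of cocycles on
   two covers. *)
Definition same_class (U U' : ordered_cover S) p
    (f : cochain (idx U) p.+1) (f' : cochain (idx U') p.+1) : Prop :=
  exists (W : ordered_cover S) (r : idx W -> idx U) (r' : idx W -> idx U')
    (g : cochain (idx W) p),
    [/\ refinement r, refinement r' &
        forall a, simplex a ->
          pullback r f a (+) pullback r' f' a = coboundary g a].

Definition zero_class (U : ordered_cover S) p (f : cochain (idx U) p.+1) : Prop :=
  same_class f (fun _ : 'I_p.+2 -> idx U => false).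

End Cech.

Definition sgn_cochain (R : realType) (n : nat) (M : topologicalType)
    (V : normedModType R) (A : atlas M V) (E : bundle2 n A) : cochain (idx E) 3 :=
  fun a => sgn R[i] (bobj E (a (inord 0)) (a (inord 1)))
                    (bobj E (a (inord 1)) (a (inord 2)))
                    (bobj E (a (inord 2)) (a (inord 3))).

Arguments sgn_cochain {R n M V A} E.

(* Main.v *)
Require Import Defs.
From HB Require Import structures.
From mathcomp Require Import all_boot all_order all_algebra all_fingroup.
From mathcomp Require Import character complex.
From mathcomp Require Import all_classical all_reals all_analysis.
Import numFieldNormedType.Exports.

Set Implicit Arguments.
Unset Strict Implicit.
Unset Printing Implicit Defensive.

Import Order.TTheory GRing.Theory Num.Theory.
Local Open Scope classical_set_scope.
Local Open Scope ring_scope.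

(** For composable objects [X], [Y], [Z], [W] of [GL], the pentagon identity [pentagon]
relates five associators.  [Det] is multiplicative for products and, in its second
component, for composition ([Det_prod], [Det_comp]); tensoring an associator with an
identity raises its sign to the power of a dimension determinant, which is 1 or -1.
Hence the pentagon becomes [sgn_pentagon], which for [X = E a b], [Y = E b c],
[Z = E c d], [W = E d e] says exactly that the coboundary of the sign cochain vanishes
([sign_cocycle]).

An equivalence is a bundle over the cylinder, whose sign cocycle restricts to the two
given ones at the ends.  So the second claim is homotopy invariance of Cech cohomology
([homotopy_invariance]): near each point of the base finitely many members of the cover
of the cylinder suffice for a whole segment, and moving through a dyadic subdivision
of it changes the pulled-back cocycle by coboundaries, given by prisms.  All signs are
handled as functions of lists of indices that are invariant under permutation and vanish
on lists with repetitions; on those, the coboundary and the prism operator are short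
recursions and the homotopy formula [prism_homotopy] is a short induction.

If [E] is equivalent to the image of an oriented bundle, then the signs of the oriented
coherence maps cobound the sign cocycle, but they are only locally constant.  On a
refinement by small neighbourhoods of points, adapted to a locally finite shrinking of
the cover, they become constants ([adapted_refinement]), which gives the vanishing of
the class ([orientable_zero_class]).

Conversely, suppose that on a refinement [W], with refinement map [r], the sign cocycle
is the coboundary of [c].  Since the unit of [GL] is strict, [E] extends to weakly
increasing indices by units and identities ([wobj], [wcoh], [wcoh_assoc]) and can be
pulled back along any weakly monotone map of index sets ([pull_bundle]).  Reordering
[W] so that [r] is weakly monotone, the pullback of [E] to [W] becomes oriented when its
coherence maps carry the signs [c] ([orient]).  The members of the old cover, multiplied
by the interval [0, 1), and those of [W], multiplied by (0, 1], cover the cylinder; the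
pullback of [E] to this cover is an equivalence from [E] to that oriented bundle
([zero_class_orientable]). *)

(** * Determinants over the ring Z x F^* *)

Lemma mxblock_Rank (R : Type) p q (p_ : 'I_p -> nat) (q_ : 'I_q -> nat)
    (B : forall i j, 'M[R]_(p_ i, q_ j)) i j x y :
  (\mxblock_(i, j) B i j) (tagnat.Rank i x) (tagnat.Rank j y) = B i j x y.
Proof.
by have /(congr1 (fun A => fun_of_matrix A x y)) := mxblockK B i j; rewrite mxE.
Qed.

Section Determinants.
Variable F : fieldType.

Lemma blockdiag_Rank r (p q : 'I_r -> nat) (A : forall j, 'M[F]_(q j, p j)) j x y :
  blockdiag A (tagnat.Rank j x) (tagnat.Rank j y) = A j x y.
Proof. by rewrite /blockdiag mxblock_Rank eqxx conform_mx_id. Qed.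

Lemma blockdiag_Rank0 r (p q : 'I_r -> nat) (A : forall j, 'M[F]_(q j, p j)) i j x y :
  i != j -> blockdiag A (tagnat.Rank i x) (tagnat.Rank j y) = 0.
Proof. by move=> /negbTE ij; rewrite /blockdiag mxblock_Rank ij mxE. Qed.

Lemma det_castmx m n (e : m = n) (A : 'M[F]_m) : \det (castmx (e, e) A) = \det A.
Proof. by case: n / e; rewrite castmx_id. Qed.

Lemma vdet_square m (f : vmor F m m) : vdet f = \det (vmx f).
Proof. by rewrite /vdet (eq_irrelevance (esym _) (erefl m)) castmx_id. Qed.

Lemma vdet_id m : vdet (vid F m) = 1.
Proof. by rewrite vdet_square det1. Qed.

Lemma vdet_comp m n p (g : vmor F n p) (f : vmor F m n) :
  vdet (vcomp g f) = vdet g * vdet f.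
Proof.
have e := vmor_dim f; case: _ / e in g f *.
have e := vmor_dim g; case: _ / e in g f *.
by rewrite !vdet_square det_mulmx.
Qed.

Lemma det_blockdiag r (p : 'I_r -> nat) (A : forall j, 'M[F]_(p j)) :
  \det (blockdiag A) = \prod_j \det (A j).
Proof.
rewrite -[blockdiag A]/(\mxdiag_j A j).
elim: r p A => [|r IH] p A.
  have det0 N (B : 'M[F]_N) : N = 0%N -> \det B = 1 by case: N B => // B; rewrite det_mx00.
  by rewrite det0 big_ord0.
by rewrite mxdiag_recl det_castmx det_ublock IH big_ord_recl.
Qed.

Lemma vdet_sum r (p q : 'I_r -> nat) (f : forall j, vmor F (p j) (q j)) :
  vdet (vsum f) = \prod_j vdet (f j).
Proof.
have e : q = p by apply: functional_extensionality_dep => j; exact: vmor_dim (f j).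
case: _ / e in f *; rewrite vdet_square det_blockdiag.
by apply: eq_bigr => j _; rewrite vdet_square.
Qed.

Lemma sum_nat_const_ord_lt r (i : 'I_r) q : (\sum_(k < r | (k < i)%N) q = i * q)%N.
Proof.
by rewrite -(big_ord_widen _ (fun=> q) (ltnW (ltn_ord i))) sum_nat_const card_ord.
Qed.

(** In lexicographic order the tensor product with an identity on the left is block
diagonal, with equal blocks. *)
Lemma det_tprod1 m q (B : 'M[F]_q) : \det (tprod (1%:M : 'M[F]_m) B) = \det B ^+ m.
Proof.
have e : (\sum_(j < m) q = m * q)%N by rewrite sum_nat_const card_ord.
have castK a b : cast_ord (esym e) (mxvec_index a b) = tagnat.Rank (p_ := fun _ => q) a b.
  apply: val_inj; rewrite [RHS]tagnat.RankEsum sum_nat_const_ord_lt.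
  exact: mxvec_index_val.
have -> : tprod (1%:M : 'M[F]_m) B = castmx (e, e) (blockdiag (fun j : 'I_m => B)).
  apply/matrixP => i j; case/mxvec_indexP: i => a b; case/mxvec_indexP: j => c d.
  rewrite tprod_index castmxE !castK mxE.
  by case: eqVneq => [->|ac]; rewrite ?blockdiag_Rank ?blockdiag_Rank0 ?mul1r ?mul0r.
by rewrite det_castmx det_blockdiag prodr_const card_ord.
Qed.

(** Exchanging the two tensor factors conjugates the matrix by a permutation, so the
determinant is that of the tensor product in the other order. *)
Lemma det_tprodr1 m q (A : 'M[F]_m) : \det (tprod A (1%:M : 'M[F]_q)) = \det A ^+ q.
Proof.
pose swap (t : 'I_(m * q)) : 'I_(m * q) :=
  let u := enum_val (cast_ord (esym (mxvec_cast m q)) t) in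
  cast_ord (mulnC q m) (mxvec_index u.2 u.1).
have swapE a b : swap (mxvec_index a b) = cast_ord (mulnC q m) (mxvec_index b a).
  by rewrite /swap /mxvec_index cast_ordK enum_rankK.
have swap_inj : injective swap.
  move=> s t; case/mxvec_indexP: s => a b; case/mxvec_indexP: t => c d.
  by rewrite !swapE => /cast_ord_inj /mxvec_index_inj[-> ->].
have -> : tprod A (1%:M : 'M[F]_q) = row_perm (perm swap_inj) (col_perm (perm swap_inj)
    (castmx (mulnC q m, mulnC q m) (tprod (1%:M : 'M[F]_q) A))).
  apply/matrixP => i j; case/mxvec_indexP: i => a b; case/mxvec_indexP: j => c d.
  by rewrite 2!mxE !permE castmxE !swapE !cast_ordK !tprod_index mulrC.
rewrite row_permE col_permE !det_mulmx det_castmx det_tprod1 !det_perm.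
by rewrite odd_permV mulrCA -signr_addb addbb mulr1.
Qed.

Lemma vdet_tens m n m' n' (f : vmor F m n) (g : vmor F m' n') :
  vdet (vtens f g) = vdet f ^+ m' * vdet g ^+ m.
Proof.
have e := vmor_dim f; case: _ / e in f *.
have e := vmor_dim g; case: _ / e in g *.
rewrite !vdet_square /= -[vmx f in LHS]mulmx1 -[vmx g in LHS]mul1mx tprodE.
by rewrite det_mulmx det_tprodr1 det_tprod1.
Qed.

Section Det.
Variable n : nat.
Implicit Types X Y Z : dims n.

Definition detmx X Y (f : mhom F X Y) : 'M[detring F]_n :=
  \matrix_(i, j)
    ((X i j : int), exist (fun x => is_true (x != 0)) _ (vdet_neq0 (f i j))).

Lemma dr_sum1 I r (P : pred I) (E : I -> detring F) :
  (\sum_(i <- r | P i) E i).1 = \sum_(i <- r | P i) (E i).1.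
Proof. exact: (big_morph (fun x : detring F => x.1)). Qed.

Lemma dr_sum2 I r (P : pred I) (E : I -> detring F) :
  sval (\sum_(i <- r | P i) E i).2 = \prod_(i <- r | P i) sval (E i).2.
Proof. exact: (big_morph (fun x : detring F => sval x.2)). Qed.

(** The ring operations of [detring] are those by which pairs of a dimension and a
determinant behave under direct sums and tensor products. *)
Lemma detmx_prod X X' Y Y' (f : mhom F X X') (g : mhom F Y Y') :
  detmx (mprodm f g) = detmx f *m detmx g.
Proof.
apply/matrixP => i k; rewrite !mxE; apply: dr_eq.
  rewrite dr_sum1 /= /mprod -natz natr_sum; apply: eq_bigr => j _.
  by rewrite !mxE /= natz PoszM.
rewrite dr_sum2 /= vdet_sum; apply: eq_bigr => j _.
by rewrite vdet_tens !mxE.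
Qed.

Lemma Det_prod X X' Y Y' (f : mhom F X X') (g : mhom F Y Y') :
  Det (mprodm f g) = Det f * Det g.
Proof. by rewrite -det_mulmx -detmx_prod. Qed.

(** [detring F] is a square-zero extension of the integers by the units of [F].  Over a
fixed matrix of dimensions the second component of a determinant is therefore a
homomorphism in the second components of the entries: the relation [K] below is
preserved by all ring operations. *)
Lemma Det_comp X Y Z (g : mhom F Y Z) (f : mhom F X Y) :
  sval (Det (mcomp g f)).2 = sval (Det g).2 * sval (Det f).2.
Proof.
have e : Y = X.
  by apply: functional_extensionality_dep => i;
     apply: functional_extensionality_dep => j; exact: vmor_dim (f i j).
case: _ / e in f *.
pose K (x y z : detring F) :=
  [/\ x.1 = y.1, y.1 = z.1 & sval x.2 = sval y.2 * sval z.2].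
suff [] : K (Det (mcomp g f)) (Det g) (Det f) by [].
have KD x y z x' y' z' : K x y z -> K x' y' z' -> K (x + x') (y + y') (z + z').
  move=> [e1 e2 e3] [e1' e2' e3']; split; rewrite /= ?e1 ?e1' ?e2 ?e2' //.
  by rewrite e3 e3' mulrACA.
have KM x y z x' y' z' : K x y z -> K x' y' z' -> K (x * x') (y * y') (z * z').
  move=> [e1 e2 e3] [e1' e2' e3']; split; rewrite /= ?e1 ?e1' ?e2 ?e2' //.
  by rewrite e3 e3' !expfzMl mulrACA.
have KN x y z : K x y z -> K (- x) (- y) (- z).
  by move=> [e1 e2 e3]; split; rewrite /= ?e1 ?e2 // e3 expfzMl.
have K0 : K 0 0 0 by split=> //=; rewrite mulr1.
have K1 : K 1 1 1 by split=> //=; rewrite mulr1.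
rewrite /Det; apply: (big_ind3 K K0 KD) => s _.
apply: (KM); first by case: odd_perm; rewrite ?expr1 ?expr0 //; exact: KN.
apply: (big_ind3 K K1 KM) => i _; rewrite !mxE; split=> //=; exact: vdet_comp.
Qed.

Lemma Det1 X Y (f : mhom F X Y) : (Det f).1 = dims_det X.
Proof.
pose K (x : detring F) (y : int) := x.1 = y.
have KD x y x' y' : K x y -> K x' y' -> K (x + x') (y + y') by rewrite /K => <- <-.
have KM x y x' y' : K x y -> K x' y' -> K (x * x') (y * y') by rewrite /K => <- <-.
rewrite -/(K _ _) /Det /dims_det; apply: (big_ind2 K (erefl : K 0 0) KD) => s _.
apply: (KM); first by case: odd_perm; rewrite ?expr1 ?expr0.
by apply: (big_ind2 K (erefl : K 1 1) KM) => i _; rewrite !mxE.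
Qed.

Lemma Det_id2 X : sval (Det (mid F X)).2 = 1.
Proof.
pose K (x : detring F) := sval x.2 = 1.
have KD x y : K x -> K y -> K (x + y) by rewrite /K /= => -> ->; rewrite mulr1.
have KM x y : K x -> K y -> K (x * y).
  by rewrite /K /= => -> ->; rewrite !exp1rz mulr1.
have KN x : K x -> K (- x) by rewrite /K /= => ->; rewrite exp1rz.
rewrite -/(K _) /Det; apply: (big_ind K _ KD) => // s _.
apply: (KM); first by case: odd_perm; rewrite ?expr1 ?expr0 //; exact: KN.
by apply: (big_ind K _ KM) => // i _; rewrite !mxE; exact: vdet_id.
Qed.

End Det.

End Determinants.

(** * The pentagon identity and its sign *)

Section Pentagon.
Variable F : fieldType.

(** Composites and tensor products of permutation matrices are compared through
what they do to basis vectors: column [q] of [A] is the basis vector [p]. *)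
Definition sends m n (A : 'M[F]_(n, m)) (q : 'I_m) (p : 'I_n) :=
  forall r, A r q = (r == p)%:R.

Lemma sends_mul m n p (A : 'M[F]_(n, m)) (B : 'M[F]_(p, n)) q r s :
  sends A q r -> sends B r s -> sends (B *m A) q s.
Proof.
move=> Aq Br t; rewrite mxE (bigD1 r) //= Aq eqxx mulr1 Br big1 ?addr0 // => u ur.
by rewrite Aq (negbTE ur) mulr0.
Qed.

Lemma sends_ext m n (A B : 'M[F]_(n, m)) :
  (forall q, exists2 p, sends A q p & sends B q p) -> A = B.
Proof. by move=> AB; apply/matrixP => i q; have [p -> ->] := AB q. Qed.

Lemma sends1 m (q : 'I_m) : sends 1%:M q q.
Proof. by move=> r; rewrite mxE. Qed.

Lemma sends_tprod m n m' n' (A : 'M[F]_(n, m)) (B : 'M[F]_(n', m')) q p q' p' :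
  sends A q p -> sends B q' p' ->
  sends (tprod A B) (mxvec_index q q') (mxvec_index p p').
Proof.
move=> Aq Bq r; case/mxvec_indexP: r => a b; rewrite tprod_index Aq Bq -natrM mulnb.
congr (_%:R); congr nat_of_bool; apply/andP/eqP => [[/eqP-> /eqP->]//|].
by move=> /mxvec_index_inj[-> ->].
Qed.

Lemma Rank_eq r (p : 'I_r -> nat) i j (x : 'I_(p i)) (y : 'I_(p j)) :
  (tagnat.Rank i x == tagnat.Rank j y) = (i == j) && (x == y :> nat).
Proof. by rewrite -tagnat.eq_Rank val_eqE. Qed.

Lemma sends_blockdiag r (p q : 'I_r -> nat) (A : forall j, 'M[F]_(q j, p j)) j s t :
  sends (A j) s t -> sends (blockdiag A) (tagnat.Rank j s) (tagnat.Rank j t).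
Proof.
move=> As u; have [i [x <-]] := Rank_surj u; have [ij|ij] := eqVneq i j.
  by case: _ / (esym ij) in x *; rewrite blockdiag_Rank As Rank_eq eqxx.
by rewrite blockdiag_Rank0 // Rank_eq (negbTE ij).
Qed.

Lemma sends_assoc n (X Y Z : dims n) i l (u : basis3 X Y Z i l) :
  sends (assoc_mx F X Y Z i l) (basis_right u) (basis_left u).
Proof.
move=> r; rewrite /assoc_mx summxE (bigD1 u) //= mxE eqxx andbT big1 ?addr0 // => v vu.
by rewrite mxE (inj_eq (@basis_right_inj _ X Y Z i l)) [u == v]eq_sym (negbTE vu) andbF.
Qed.

Section Basis3.
Variables (n : nat) (X Y Z : dims n) (i l : 'I_n).

Definition basis_mk (j k : 'I_n) (a : 'I_(X i j)) (b : 'I_(Y j k)) (c : 'I_(Z k l)) :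
    basis3 X Y Z i l :=
  Tagged (fun jk : 'I_n * 'I_n =>
    ('I_(X i jk.1) * 'I_(Y jk.1 jk.2) * 'I_(Z jk.2 l))%type) (i := (j, k)) (a, b, c).

End Basis3.

Lemma mhom_ext n (X Y : dims n) (f g : mhom F X Y) :
  (forall i j, vmx (f i j) = vmx (g i j)) -> f = g.
Proof.
move=> fg; apply: functional_extensionality_dep => i.
apply: functional_extensionality_dep => j; exact/vmor_inj.
Qed.

(** All the maps permute bases.  Both composites send a tensor of four basis vectors
bracketed to the right to the same tensor bracketed to the left. *)
Theorem pentagon n (X Y Z W : dims n) :
  mcomp (massoc F (mprod X Y) Z W) (massoc F X Y (mprod Z W)) =
  mcomp (mprodm (massoc F X Y Z) (mid F W))
    (mcomp (massoc F X (mprod Y Z) W) (mprodm (mid F X) (massoc F Y Z W))).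
Proof.
apply: mhom_ext => i m; apply: sends_ext => q /=.
have [j [x <-]] := Rank_surj q; have [a [{}x <-]] := mxvec_index_surj x.
have [k [{}x <-]] := Rank_surj x; have [b [{}x <-]] := mxvec_index_surj x.
have [l [{}x <-]] := Rank_surj x; have [c [d <-]] := mxvec_index_surj x.
pose ab : 'I_(mprod X Y i k) :=
  tagnat.Rank (p_ := fun j => (X i j * Y j k)%N) j (mxvec_index a b).
pose cd : 'I_(mprod Z W k m) :=
  tagnat.Rank (p_ := fun l => (Z k l * W l m)%N) l (mxvec_index c d).
pose bc : 'I_(mprod Y Z j l) :=
  tagnat.Rank (p_ := fun k => (Y j k * Z k l)%N) k (mxvec_index b c).
exists (basis_left (basis_mk ab c d)).
- apply: (sends_mul (r := basis_left (basis_mk a b cd))).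
    exact: (sends_assoc (basis_mk a b cd)).
  exact: (sends_assoc (basis_mk ab c d)).
- apply: (sends_mul (r := basis_left (basis_mk a bc d))).
    apply: (sends_mul (r := basis_right (basis_mk a bc d))).
      apply: sends_blockdiag; apply: sends_tprod; first exact: sends1.
      exact: (sends_assoc (basis_mk b c d)).
    exact: (sends_assoc (basis_mk a bc d)).
  apply: sends_blockdiag; apply: sends_tprod; last exact: sends1.
  exact: (sends_assoc (basis_mk a b c)).
Qed.

End Pentagon.

Section SgnPentagon.
Variables (F : fieldType) (n : nat).
Hypothesis F2 : (2%:R : F) != 0.

Lemma signr_inj (s t : bool) : (-1) ^+ s = (-1) ^+ t :> F -> s = t.
Proof.
have neq : (1 : F) == -1 = false.
  by apply/negbTE; rewrite -subr_eq0 opprK -(natrD _ 1 1).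
by case: s t => [] [] //= /eqP; rewrite ?[_ == 1]eq_sym neq.
Qed.

Lemma signr_unit_exp (s : bool) (m : int) : (m == 1) || (m == -1) ->
  ((-1) ^+ s : F) ^ m = (-1) ^+ s.
Proof. by case/orP => /eqP->; rewrite ?expr1z ?exprN1 ?invr_sign. Qed.

(** The second component of [Det] of the pentagon.  The two associators tensored with an
identity enter with the dimension determinants of [X] and [W] as exponents, which are
1 or -1 and leave a sign unchanged. *)
Theorem sgn_pentagon (X Y Z W : glob n) :
  sgn F (mprod X Y) Z W (+) sgn F X Y (mprod Z W) =
  sgn F X Y Z (+) (sgn F X (mprod Y Z) W (+) sgn F Y Z W).
Proof.
apply: signr_inj; rewrite !signr_addb -!sgn_spec.
have := congr1 (fun f => sval (Det f).2) (pentagon F X Y Z W).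
rewrite /= !Det_comp => ->; rewrite !Det_prod /= !Det1 !Det_id2 !exp1rz mulr1 mul1r.
by rewrite !sgn_spec !signr_unit_exp ?globP.
Qed.

End SgnPentagon.

(** * The strict unit *)

Section Cast.
Variable F : fieldType.

Lemma vcast_subproof m n (e : m = n) (A := \matrix_(p < n, q < m) ((p == q :> nat)%:R : F)) :
  row_free A && row_full A.
Proof.
rewrite {}/A; case: n / e.
rewrite (_ : \matrix_(p, q) _ = 1%:M) ?(vmxP (vid F m)) //.
by apply/matrixP => p q; rewrite !mxE.
Qed.
(** The unit is strict, but its defining equalities of dimensions are only propositional;
morphisms are transported along them by composing with these identity matrices. *)
Definition vcast m n (e : m = n) : vmor F m n := VMor (vcast_subproof e).

Lemma vcast_id m (e : m = m) : vcast e = vid F m.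
Proof. by apply: vmor_inj; apply/matrixP => p q; rewrite !mxE. Qed.

Lemma sends_vcast m n (e : m = n) q : sends (vcast e) q (cast_ord e q).
Proof. by move=> r; rewrite mxE. Qed.

Lemma vcast_mulE m n p (e : n = p) (A : 'M[F]_(n, m)) r q :
  (vcast e *m A) r q = A (cast_ord (esym e) r) q.
Proof. by case: p / e r => r; rewrite vcast_id mul1mx cast_ord_id. Qed.

Lemma mul_vcastE m n p (e : m = n) (A : 'M[F]_(p, n)) r q :
  (A *m vcast e) r q = A r (cast_ord e q).
Proof. by case: n / e A => A; rewrite vcast_id mulmx1 cast_ord_id. Qed.

Section Matrices.
Variable n : nat.
Implicit Types X Y Z S T : dims n.

Definition mcast X Y (e : X = Y) : mhom F X Y :=
  fun i j => vcast (congr1 (fun D : dims n => D i j) e).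

Lemma mcast_id X (e : X = X) : mcast e = mid F X.
Proof. by apply: mhom_ext => i j; rewrite /mcast vcast_id. Qed.

Lemma mcomp1m X Y (f : mhom F X Y) : mcomp (mid F Y) f = f.
Proof. by apply: mhom_ext => i j; exact: mul1mx. Qed.

Lemma mcompm1 X Y (f : mhom F X Y) : mcomp f (mid F X) = f.
Proof. by apply: mhom_ext => i j; exact: mulmx1. Qed.

Lemma mcompA X Y Z T (h : mhom F Z T) (g : mhom F Y Z) (f : mhom F X Y) :
  mcomp h (mcomp g f) = mcomp (mcomp h g) f.
Proof. by apply: mhom_ext => i j; exact: mulmxA. Qed.

Lemma mprodm1 X Y : mprodm (mid F X) (mid F Y) = mid F (mprod X Y).
Proof.
apply: mhom_ext => i k /=; rewrite -blockdiag1; congr blockdiag.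
by apply: functional_extensionality_dep => j; exact: tprod1.
Qed.

Lemma mcast_trans X Y Z (e : X = Y) (e' : Y = Z) (e'' : X = Z) :
  mcomp (mcast e') (mcast e) = mcast e''.
Proof. by case: Z / e' e'' => e''; rewrite mcast_id mcomp1m (Prop_irrelevance e e''). Qed.

Lemma mprodm_cast X X' Y Y' (e : X = X') (e' : Y = Y')
    (e'' : mprod X Y = mprod X' Y') :
  mprodm (mcast e) (mcast e') = mcast e''.
Proof. by case: X' / e e'' => e''; case: Y' / e' e'' => e''; rewrite !mcast_id mprodm1. Qed.

Definition munit : dims n := fun i j => i == j.

Lemma mprod1l X i k : mprod munit X i k = X i k.
Proof.
rewrite /mprod (bigD1 i) //= /munit eqxx mul1n big1 ?addn0 // => j /negbTE.
by rewrite eq_sym => ->.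
Qed.

Lemma mprod1r X i k : mprod X munit i k = X i k.
Proof.
by rewrite /mprod (bigD1 k) //= /munit eqxx muln1 big1 ?addn0 // => j /negbTE ->; rewrite muln0.
Qed.

Lemma dims_eq X Y : (forall i j, X i j = Y i j) -> X = Y.
Proof.
move=> XY; apply: functional_extensionality_dep => i.
by apply: functional_extensionality_dep => j.
Qed.

Lemma munit_ord i j (a : 'I_(munit i j)) : i = j /\ a = 0%N :> nat.
Proof.
by case: a; rewrite /munit; case: (eqVneq i j) => // -> [].
Qed.

Lemma sum_munit_lt (i j : 'I_n) (E : 'I_n -> nat) : (j <= i)%N ->
  (\sum_(k < n | (k < j)%N) munit i k * E k = 0)%N.
Proof.
move=> ji; apply: big1 => k kj; rewrite /munit; case: eqVneq => // ik.
by move: kj; rewrite -ik ltnNge ji.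
Qed.

Lemma sum_munit_lt_r (i j : 'I_n) (E : 'I_n -> nat) : (j <= i)%N ->
  (\sum_(k < n | (k < j)%N) E k * munit k i = 0)%N.
Proof.
move=> ji; rewrite -[RHS](sum_munit_lt E ji); apply: eq_bigr => k _.
by rewrite mulnC /munit eq_sym.
Qed.

Section Values.
Variables (X Y Z : dims n) (i j k l : 'I_n).
Variables (a : 'I_(X i j)) (b : 'I_(Y j k)) (c : 'I_(Z k l)).

Lemma basis_right_val :
  basis_right (basis_mk a b c) =
  (\sum_(j' < n | (j' < j)%N) X i j' * mprod Y Z j' l +
   (a * mprod Y Z j l +
     (\sum_(k' < n | (k' < k)%N) Y j k' * Z k' l + (b * Z k l + c))))%N :> nat.
Proof.
by rewrite /basis_right tagnat.RankEsum mxvec_index_val tagnat.RankEsum mxvec_index_val.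
Qed.

Lemma basis_left_val :
  basis_left (basis_mk a b c) =
  (\sum_(k' < n | (k' < k)%N) mprod X Y i k' * Z k' l +
   ((\sum_(j' < n | (j' < j)%N) X i j' * Y j' k + (a * Y j k + b)) * Z k l + c))%N :> nat.
Proof.
by rewrite /basis_left tagnat.RankEsum mxvec_index_val tagnat.RankEsum mxvec_index_val.
Qed.

End Values.

(** Both bracketings order the basis lexicographically, but by different keys; the
associator is the identity matrix when these orders happen to agree. *)
Lemma assoc_cast X Y Z (e : mprod X (mprod Y Z) = mprod (mprod X Y) Z) :
  (forall i j k l (a : 'I_(X i j)) (b : 'I_(Y j k)) (c : 'I_(Z k l)),
    basis_left (basis_mk a b c) = basis_right (basis_mk a b c) :> nat) ->
  massoc F X Y Z = mcast e.
Proof.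
move=> lr; apply: mhom_ext => i l; apply: sends_ext => q /=.
have [[[j k] [[a b] c]] <-] := basis_right_surj q.
eexists; first exact: sends_assoc.
rewrite [X in sends _ _ X](_ : _ = cast_ord
  (congr1 (fun D : dims n => D i l) e) (basis_right (basis_mk a b c))).
  exact: sends_vcast.
by apply: val_inj; exact: lr.
Qed.

(** A unit factor leaves one summand in the sums over one of its two indices, and the
two lexicographic orders agree. *)
Lemma assoc_unit1 Y Z e : massoc F munit Y Z = mcast e.
Proof.
apply: assoc_cast => i j k l a b c; rewrite basis_left_val basis_right_val.
have [ij a0] := munit_ord a; case: _ / ij in a b a0 *.
rewrite !sum_munit_lt // a0 !mul0n !add0n; congr (_ + _)%N.
by apply: eq_bigr => k' _; rewrite mprod1l.
Qed.

Lemma assoc_unit2 X Z e : massoc F X munit Z = mcast e.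
Proof.
apply: assoc_cast => i j k l a b c; rewrite basis_left_val basis_right_val.
have [jk b0] := munit_ord b; case: _ / jk in b c b0 *.
rewrite sum_munit_lt_r // sum_munit_lt // b0 mprod1l /munit eqxx mul0n muln1 !add0n addn0.
by congr (_ + _)%N; apply: eq_bigr => k' _; rewrite mprod1l mprod1r.
Qed.

Lemma assoc_unit3 X Y e : massoc F X Y munit = mcast e.
Proof.
apply: assoc_cast => i j k l a b c; rewrite basis_left_val basis_right_val.
have [kl c0] := munit_ord c; case: _ / kl in c c0 *.
rewrite !sum_munit_lt_r // c0 mprod1r /munit eqxx !muln1 !addn0 !add0n.
by congr (_ + _)%N; apply: eq_bigr => k' _; rewrite mprod1r.
Qed.

(** The product with the unit has a single nonzero block, indexed by the diagonal entry
of the unit; [emb] includes that block. *)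
Lemma unit_natural_l S T (f : mhom F S T) (eS : mprod munit S = S) (eT : mprod munit T = T) :
  mcomp (mcast eT) (mprodm (mid F munit) f) = mcomp f (mcast eS).
Proof.
apply: mhom_ext => i k /=; apply/matrixP => p q.
have ii : (0 < munit i i)%N by rewrite /munit eqxx.
pose emb (D : dims n) (x : 'I_(D i k)) : 'I_(mprod munit D i k) :=
  tagnat.Rank (p_ := fun j => (munit i j * D j k)%N) i (mxvec_index (Ordinal ii) x).
have embE D (e : D i k = mprod munit D i k) x : emb D x = cast_ord e x.
  apply: val_inj; rewrite /emb [LHS]tagnat.RankEsum mxvec_index_val sum_munit_lt //.
have [x qx] : exists x, q = emb S x.
  exists (cast_ord (mprod1l S i k) q).
  by rewrite embE ?mprod1l // => e; apply: val_inj.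
have e (D D' : dims n) (E : D = D') : D i k = D' i k by rewrite E.
rewrite [LHS](vcast_mulE (e _ _ eT)) [RHS](mul_vcastE (e _ _ eS)) -(embE T) qx.
have -> : cast_ord (e _ _ eS) (emb S x) = x.
  by rewrite (embE S (esym (e _ _ eS))) cast_ordKV.
by rewrite blockdiag_Rank tprod_index mxE eqxx mul1r.
Qed.

Lemma unit_natural_r S T (f : mhom F S T) (eS : mprod S munit = S) (eT : mprod T munit = T) :
  mcomp (mcast eT) (mprodm f (mid F munit)) = mcomp f (mcast eS).
Proof.
apply: mhom_ext => i k /=; apply/matrixP => p q.
have kk : (0 < munit k k)%N by rewrite /munit eqxx.
pose emb (D : dims n) (x : 'I_(D i k)) : 'I_(mprod D munit i k) :=
  tagnat.Rank (p_ := fun j => (D i j * munit j k)%N) k (mxvec_index x (Ordinal kk)).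
have embE D (e : D i k = mprod D munit i k) x : emb D x = cast_ord e x.
  apply: val_inj; rewrite /emb [LHS]tagnat.RankEsum mxvec_index_val sum_munit_lt_r //=.
  by rewrite /munit eqxx muln1 addn0.
have [x qx] : exists x, q = emb S x.
  exists (cast_ord (mprod1r S i k) q).
  by rewrite embE ?mprod1r // => e; apply: val_inj.
have e (D D' : dims n) (E : D = D') : D i k = D' i k by rewrite E.
rewrite [LHS](vcast_mulE (e _ _ eT)) [RHS](mul_vcastE (e _ _ eS)) -(embE T) qx.
have -> : cast_ord (e _ _ eS) (emb S x) = x.
  by rewrite (embE S (esym (e _ _ eS))) cast_ordKV.
by rewrite blockdiag_Rank tprod_index mxE eqxx mulr1.
Qed.

End Matrices.
End Cast.

(** * Coherence maps for weakly increasing indices *)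

Section WeakCoherence.
Variables (F : fieldType) (n : nat).
Implicit Types U X Y Z T : dims n.

(** When two consecutive indices of a quadruple coincide, the object between them is the
unit [U], and two of the four coherence maps are identities.  The coherence condition
then holds for every choice [f] of the other two; this lemma and the next two treat
the three positions of [U]. *)
Lemma coherence_unit_l U Y Z T (f : mhom F (mprod Y Z) T)
    (e1 : mprod U T = T) (e2 : mprod U Y = Y) : U = @munit n ->
  mcomp (mcast F e1) (mprodm (mid F U) f) =
  mcomp (mcomp f (mprodm (mcast F e2) (mid F Z))) (massoc F U Y Z).
Proof.
move=> UE; case: _ / (esym UE) in e1 e2 *.
have e3 : mprod (@munit n) (mprod Y Z) = mprod (mprod (@munit n) Y) Z.
  by apply: dims_eq => i k; rewrite mprod1l e2.
have e4 : mprod (mprod (@munit n) Y) Z = mprod Y Z by rewrite e2.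
have e5 : mprod (@munit n) (mprod Y Z) = mprod Y Z by rewrite e3.
rewrite (unit_natural_l f e5 e1) (assoc_unit1 F e3) -(mcast_id F (erefl Z)).
by rewrite (mprodm_cast F e2 (erefl Z) e4) -mcompA (mcast_trans F e3 e4 e5).
Qed.

Lemma coherence_unit_m U X Z T (f : mhom F (mprod X Z) T)
    (e1 : mprod U Z = Z) (e2 : mprod X U = X) : U = @munit n ->
  mcomp f (mprodm (mid F X) (mcast F e1)) =
  mcomp (mcomp f (mprodm (mcast F e2) (mid F Z))) (massoc F X U Z).
Proof.
move=> UE; case: _ / (esym UE) in e1 e2 *.
have e3 : mprod X (mprod (@munit n) Z) = mprod (mprod X (@munit n)) Z by rewrite e1 e2.
have e4 : mprod (mprod X (@munit n)) Z = mprod X Z by rewrite e2.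
have e5 : mprod X (mprod (@munit n) Z) = mprod X Z by rewrite e1.
rewrite (assoc_unit2 F e3) -(mcast_id F (erefl Z)) -(mcast_id F (erefl X)).
rewrite (mprodm_cast F e2 (erefl Z) e4) (mprodm_cast F (erefl X) e1 e5).
by rewrite -mcompA (mcast_trans F e3 e4 e5).
Qed.

Lemma coherence_unit_r U X Y T (f : mhom F (mprod X Y) T)
    (e1 : mprod Y U = Y) (e2 : mprod T U = T) : U = @munit n ->
  mcomp f (mprodm (mid F X) (mcast F e1)) =
  mcomp (mcomp (mcast F e2) (mprodm f (mid F U))) (massoc F X Y U).
Proof.
move=> UE; case: _ / (esym UE) in e1 e2 *.
have e4 : mprod X (mprod Y (@munit n)) = mprod X Y by rewrite e1.
have e5 : mprod (mprod X Y) (@munit n) = mprod X Y.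
  by apply: dims_eq => i k; rewrite mprod1r.
have e3 : mprod X (mprod Y (@munit n)) = mprod (mprod X Y) (@munit n) by rewrite e4 e5.
rewrite (unit_natural_r f e5 e2) (assoc_unit3 F e3) -(mcast_id F (erefl X)).
by rewrite (mprodm_cast F (erefl X) e1 e4) -mcompA (mcast_trans F e3 e5 e4).
Qed.

End WeakCoherence.

Section Gl.
Variables (R : realType) (n : nat).

Lemma glob_eq (X Y : glob n) : gldims X = gldims Y -> X = Y.
Proof.
by case: X Y => [X pX] [Y pY] /= e; case: _ / e in pY *; rewrite (bool_irrelevance pX pY).
Qed.

Lemma munit_subproof : (dims_det (@munit n) == 1) || (dims_det (@munit n) == -1).
Proof.
suff -> : dims_det (@munit n) = 1 by [].
rewrite /dims_det -[RHS](det1 int n); congr (\det _); apply/matrixP => i j.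
by rewrite !mxE /munit; case: eqVneq.
Qed.
Definition gunit : glob n := GlOb munit_subproof.

Definition gcast (X Y : glob n) (e : X = Y) : mhom R[i] X Y :=
  mcast R[i] (congr1 (@gldims n) e).

Lemma gcast_id (X : glob n) (e : X = X) : gcast e = mid R[i] X.
Proof. exact: mcast_id. Qed.

Definition conj_cast (X Y T X' Y' T' : glob n) (eX : X' = X) (eY : Y' = Y) (eT : T' = T)
    (f : mhom R[i] (glprod X Y) T) : mhom R[i] (glprod X' Y') T' :=
  mcomp (gcast (esym eT)) (mcomp f (gcast (f_equal2 (@glprod n) eX eY))).

Lemma conj_cast_id (X Y T : glob n) eX eY eT (f : mhom R[i] (glprod X Y) T) :
  conj_cast (X := X) (Y := Y) (X' := X) (Y' := Y) (T' := T) eX eY eT f = f.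
Proof. by rewrite /conj_cast !gcast_id mcompm1 mcomp1m. Qed.

Lemma conj_cast_assoc (X Y Z P Q T X' Y' Z' P' Q' T' : glob n)
    (eX : X' = X) (eY : Y' = Y) (eZ : Z' = Z) (eP : P' = P) (eQ : Q' = Q) (eT : T' = T)
    (f1 : mhom R[i] (glprod X Q) T) (f2 : mhom R[i] (glprod Y Z) Q)
    (f3 : mhom R[i] (glprod P Z) T) (f4 : mhom R[i] (glprod X Y) P) :
  mcomp f1 (mprodm (mid R[i] X) f2) =
    mcomp (mcomp f3 (mprodm f4 (mid R[i] Z))) (massoc R[i] X Y Z) ->
  mcomp (conj_cast eX eQ eT f1) (mprodm (mid R[i] X') (conj_cast eY eZ eQ f2)) =
  mcomp (mcomp (conj_cast eP eZ eT f3) (mprodm (conj_cast eX eY eP f4) (mid R[i] Z')))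
    (massoc R[i] X' Y' Z').
Proof. by subst => H; rewrite !conj_cast_id. Qed.

Lemma arrow_conj_cast (X Y T X' Y' T' : glob n) (eX : X' = X) (eY : Y' = Y) (eT : T' = T)
    (f : mhom R[i] (glprod X Y) T) :
  arrow (B := GL R n) (X := glprod X' Y') (Y := T') (conj_cast eX eY eT f) =
  arrow (B := GL R n) (X := glprod X Y) (Y := T) f.
Proof. by subst; rewrite conj_cast_id. Qed.

Lemma iso_conj_cast (X Y T X' Y' T' : glob n) (eX : X' = X) (eY : Y' = Y) (eT : T' = T)
    (f : mhom R[i] (glprod X Y) T) :
  is_iso (B := GL R n) (X := glprod X Y) (Y := T) f ->
  is_iso (B := GL R n) (X := glprod X' Y') (Y := T') (conj_cast eX eY eT f).
Proof. by subst; rewrite conj_cast_id. Qed.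

Lemma coords_conj_cast (X Y T X' Y' T' : glob n) (eX : X' = X) (eY : Y' = Y) (eT : T' = T) p :
  @gl_coords R n (glprod X' Y') T' p ->
  @gl_coords R n (glprod X Y) T (p \o conj_cast eX eY eT).
Proof.
subst => cp; rewrite (_ : p \o _ = p) //; apply: functional_extensionality_dep => f /=.
by rewrite conj_cast_id.
Qed.

Lemma iso_gcast (X Y : glob n) (e : X = Y) :
  is_iso (B := GL R n) (X := X) (Y := Y) (gcast e).
Proof. by case: Y / e; rewrite gcast_id; exists (mid R[i] X); exact: mcomp1m. Qed.

(** An associator that is an identity matrix has trivial sign: after identifying its
source and target, it is an identity morphism. *)
Lemma sgn_cast (X Y Z : glob n) e : massoc R[i] X Y Z = mcast R[i] e ->
  sgn R[i] X Y Z = false.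
Proof.
move=> aE; apply: (@signr_inj R[i]); first by rewrite pnatr_eq0.
rewrite -sgn_spec aE expr0.
have cast2 D D' (e' : D = D' :> dims n) : sval (Det (mcast R[i] e')).2 = 1.
  by case: D' / e'; rewrite mcast_id Det_id2.
exact: cast2.
Qed.

Lemma mprodA (X Y Z : dims n) : mprod X (mprod Y Z) = mprod (mprod X Y) Z.
Proof. by apply: dims_eq => i l; exact: esym (vmor_dim (massoc R[i] X Y Z i l)). Qed.

Lemma sgn_unit (X Y Z : glob n) :
  [\/ X = gunit, Y = gunit | Z = gunit] -> sgn R[i] X Y Z = false.
Proof.
case=> ->.
- exact: (@sgn_cast gunit Y Z (mprodA _ _ _) (assoc_unit1 R[i] _)).
- exact: (@sgn_cast X gunit Z (mprodA _ _ _) (assoc_unit2 R[i] _)).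
- exact: (@sgn_cast X Y gunit (mprodA _ _ _) (assoc_unit3 R[i] _)).
Qed.

End Gl.

Section WeakBundle.
Variables (R : realType) (n : nat).
Variables (M : topologicalType) (V : normedModType R) (A : atlas M V) (S : set M).
Variable E : bundle (GL R n) A S.
Implicit Types u v w t : idx E.

(** A refinement map sends several indices of the finer cover to the same index of the
bundle.  To pull the bundle back, the objects are extended by the unit to the diagonal,
and the coherence maps, in [wcoh], by identities. *)
Definition wobj u v : glob n := if u == v then @gunit n else bobj E u v.

Lemma wobj_unit u : wobj u u = @gunit n. Proof. by rewrite /wobj eqxx. Qed.

Lemma wobj_lt u v : (u < v)%O -> wobj u v = bobj E u v.
Proof. by rewrite /wobj lt_neqAle => /andP[/negbTE ->]. Qed.

Lemma wobj_prod u v w : (u <= v)%O -> (v <= w)%O ->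
  glprod (wobj u v) (wobj v w) = wobj u w.
Proof.
rewrite le_eqVlt => /predU1P[->|uv].
  by move=> _; rewrite wobj_unit; apply: glob_eq; apply: dims_eq => i k; exact: mprod1l.
rewrite le_eqVlt => /predU1P[<-|vw].
  by rewrite wobj_unit; apply: glob_eq; apply: dims_eq => i k; exact: mprod1r.
rewrite (wobj_lt uv) (wobj_lt vw) (wobj_lt (lt_trans uv vw)).
exact: (bobj_prod uv vw).
Qed.

Definition wcoh_lt u v w (uv : (u < v)%O) (vw : (v < w)%O) (x : M) :
    mhom R[i] (glprod (wobj u v) (wobj v w)) (wobj u w) :=
  conj_cast (wobj_lt uv) (wobj_lt vw) (wobj_lt (lt_trans uv vw)) (bcoh E uv vw x).

Definition wcoh u v w (uv : (u <= v)%O) (vw : (v <= w)%O) (x : M) :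
    mhom R[i] (glprod (wobj u v) (wobj v w)) (wobj u w) :=
  match pselect ((u < v)%O /\ (v < w)%O) with
  | left h => wcoh_lt (proj1 h) (proj2 h) x
  | right _ => gcast R (wobj_prod uv vw)
  end.

Lemma wcohE_lt u v w uv vw (uv' : (u < v)%O) (vw' : (v < w)%O) x :
  wcoh uv vw x = wcoh_lt uv' vw' x.
Proof.
rewrite /wcoh; case: pselect => h; last by case: (h (conj uv' vw')).
by rewrite (bool_irrelevance (proj1 h) uv') (bool_irrelevance (proj2 h) vw').
Qed.

Lemma wcohE_eq u v w uv vw x : (u == v) || (v == w) ->
  wcoh uv vw x = gcast R (@wobj_prod u v w uv vw).
Proof.
move=> uvw; rewrite /wcoh; case: pselect => // -[h1 h2].
by move: uvw; rewrite (lt_eqF h1) (lt_eqF h2).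
Qed.

Lemma wcoh_iso u v w (uv : (u <= v)%O) (vw : (v <= w)%O) x :
  (E u `&` E v `&` E w) x ->
  is_iso (B := GL R n) (X := glprod (wobj u v) (wobj v w)) (Y := wobj u w) (wcoh uv vw x).
Proof.
move=> Ex; have [/andP[h1 h2]|] := boolP ((u < v) && (v < w))%O.
  by rewrite (wcohE_lt _ _ h1 h2); apply: iso_conj_cast; exact: (bcoh_iso h1 h2).
rewrite !lt_neqAle uv vw !andbT negb_and !negbK => uvw.
by rewrite wcohE_eq //; exact: iso_gcast.
Qed.

Lemma arrow_wcoh u v w (uv : (u <= v)%O) (vw : (v <= w)%O)
    (uv' : (u < v)%O) (vw' : (v < w)%O) x :
  arrow (B := GL R n) (X := glprod (wobj u v) (wobj v w)) (Y := wobj u w) (wcoh uv vw x) =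
  arrow (bcoh E uv' vw' x).
Proof. by rewrite (wcohE_lt _ _ uv' vw'); exact: arrow_conj_cast. Qed.

(** For strictly increasing indices this is the coherence condition of [E], transported
along [wobj_lt]; otherwise two neighbours agree and strictness of the unit applies. *)
Lemma wcoh_assoc u v w t (uv : (u <= v)%O) (vw : (v <= w)%O) (wt : (w <= t)%O)
    (uw : (u <= w)%O) (vt : (v <= t)%O) x :
  (E u `&` E v `&` E w `&` E t) x ->
  mcomp (wcoh uv vt x) (mprodm (mid R[i] (wobj u v)) (wcoh vw wt x)) =
  mcomp (mcomp (wcoh uw wt x) (mprodm (wcoh uv vw x) (mid R[i] (wobj w t))))
    (massoc R[i] (wobj u v) (wobj v w) (wobj w t)).
Proof.
move=> Ex.
have [uvE|uv'] := eqVneq u v.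
  case: _ / uvE in vw vt uv Ex *; rewrite [wcoh uv vt x]wcohE_eq ?eqxx //.
  rewrite [wcoh uv vw x]wcohE_eq ?eqxx // (bool_irrelevance vw uw).
  by apply: coherence_unit_l; rewrite wobj_unit.
have [vwE|vw'] := eqVneq v w.
  case: _ / vwE in wt uw vw Ex *; rewrite [wcoh vw wt x]wcohE_eq ?eqxx //.
  rewrite [wcoh uv vw x]wcohE_eq ?eqxx ?orbT //.
  rewrite (bool_irrelevance vt wt) (bool_irrelevance uw uv).
  by apply: coherence_unit_m; rewrite wobj_unit.
have [wtE|wt'] := eqVneq w t.
  case: _ / wtE in vt wt Ex *; rewrite [wcoh vw wt x]wcohE_eq ?eqxx ?orbT //.
  rewrite [wcoh uw wt x]wcohE_eq ?eqxx ?orbT // (bool_irrelevance vt vw).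
  by apply: coherence_unit_r; rewrite wobj_unit.
have ltuv : (u < v)%O by rewrite lt_neqAle uv' uv.
have ltvw : (v < w)%O by rewrite lt_neqAle vw' vw.
have ltwt : (w < t)%O by rewrite lt_neqAle wt' wt.
have ltuw := lt_trans ltuv ltvw; have ltvt := lt_trans ltvw ltwt.
rewrite (wcohE_lt _ _ ltuv ltvt) (wcohE_lt _ _ ltvw ltwt).
rewrite (wcohE_lt _ _ ltuw ltwt) (wcohE_lt _ _ ltuv ltvw) /wcoh_lt.
rewrite (bool_irrelevance (lt_trans ltvw ltwt) ltvt).
rewrite (bool_irrelevance (lt_trans ltuv ltvw) ltuw).
rewrite (bool_irrelevance (lt_trans ltuw ltwt) (lt_trans ltuv ltvt)).
apply: conj_cast_assoc; exact: (bcoh_assoc ltuv ltvw ltwt ltuw ltvt Ex).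
Qed.

End WeakBundle.

Arguments wobj {R n M V A S} E u v.

(** * Cochains as functions of lists of indices *)

Section ListCochains.

(** The coboundary: a face of the list arises by deleting its head, or by keeping the head
and deleting a later vertex. *)
Fixpoint seq_delta (T : Type) (c : seq T -> bool) (s : seq T) : bool :=
  if s is x :: s' then c s' (+) seq_delta (c \o cons x) s' else false.

(** The list consists of the pairs of vertices [(u i, v i)] of two simplices; the result
is the sum of [c] over the simplices [u 0, .., u k, v k, .., v p] of the prism between
them. *)
Fixpoint prism (T : Type) (c : seq T -> bool) (s : seq (T * T)) : bool :=
  if s is p :: s' then c [:: p.1, p.2 & unzip2 s'] (+) prism (c \o cons p.1) s'
  else false.

Lemma seq_delta_eq T (c c' : seq T -> bool) : c =1 c' -> seq_delta c =1 seq_delta c'.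
Proof.
move=> cc' s; elim: s c c' cc' => //= x s IH c c' cc'.
by rewrite cc'; congr addb; apply: IH => t /=.
Qed.

Lemma seq_delta_add T (c c' : seq T -> bool) s :
  seq_delta (fun t => c t (+) c' t) s = seq_delta c s (+) seq_delta c' s.
Proof.
elim: s c c' => //= x s IH c c'.
by rewrite addbACA -IH.
Qed.

Lemma seq_delta_map T T' (h : T -> T') (c : seq T' -> bool) s :
  seq_delta (c \o map h) s = seq_delta c (map h s).
Proof. by elim: s c => //= x s IH c; rewrite -IH. Qed.

Lemma prism_eq T (c c' : seq T -> bool) : c =1 c' -> prism c =1 prism c'.
Proof.
move=> cc' s; elim: s c c' cc' => //= x s IH c c' cc'.
by rewrite cc'; congr addb; apply: IH => t /=.
Qed.

Lemma prism_add T (c c' : seq T -> bool) s :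
  prism (fun t => c t (+) c' t) s = prism c s (+) prism c' s.
Proof.
elim: s c c' => //= x s IH c c'.
by rewrite addbACA -IH.
Qed.

(** The boundary of a prism consists of its two ends and of the prism over the boundary.
The recursive forms of both operators make this an induction on the list. *)
Lemma prism_homotopy T (c : seq T -> bool) s :
  seq_delta (prism c) s (+) prism (seq_delta c) s = c (unzip1 s) (+) c (unzip2 s).
Proof.
elim: s c => [|[x y] s IH] c /=; first by rewrite addbb.
rewrite (@seq_delta_eq _ (prism c \o cons (x, y)) (fun t =>
  (c \o cons x \o cons y \o @unzip2 T T) t (+) prism (c \o cons x) t)) //.
rewrite seq_delta_add (seq_delta_map snd (c \o cons x \o cons y)).
rewrite (@prism_eq _ (seq_delta c \o cons x) (fun t => c t (+) seq_delta (c \o cons x) t)) //.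
rewrite prism_add; have /= := IH (c \o cons x).
move: (seq_delta (prism (c \o cons x)) s) (prism (seq_delta (c \o cons x)) s) => a b.
move: (prism c s) (c _) (c _) (c _) (seq_delta _ _) => a1 a2 a3 a4 a5.
by case: a b a1 a2 a3 a4 a5 => [] [] [] [] [] [] [].
Qed.

Lemma seq_delta_sum T (c : seq T -> bool) s :
  seq_delta c s = \big[addb/false]_(k < size s) c (take k s ++ drop k.+1 s).
Proof.
elim: s c => [|x s IH] c /=; first by rewrite big_ord0.
rewrite big_ord_recl /= drop0 IH; congr addb.
Qed.

Lemma prism_diag T (c : seq T -> bool) s :
  (forall s1 x s2, c (s1 ++ [:: x, x & s2]) = false) ->
  prism c [seq (x, x) | x <- s] = false.
Proof.
elim: s c => //= x s IH c c0; rewrite (c0 [::]) IH // => s1 y s2.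
exact: (c0 (x :: s1)).
Qed.

Section Symmetric.
Variable T : eqType.
Implicit Types (c : seq T -> bool) (s : seq T).

(** With coefficients of order two, an alternating cochain is the same as a function of
finite sets of indices, extended by zero to degenerate simplices. *)
Definition symmetric_cochain c :=
  (forall s t, perm_eq s t -> c s = c t) /\ (forall s, ~~ uniq s -> c s = false).

Lemma symmetric_prism_diag c s : symmetric_cochain c ->
  prism c [seq (x, x) | x <- s] = false.
Proof.
move=> [_ c0]; apply: prism_diag => s1 x s2; apply: c0.
by rewrite cat_uniq /= mem_head !andbF.
Qed.

Lemma seq_delta_rem c s : (forall s t, perm_eq s t -> c s = c t) ->
  seq_delta c s = \big[addb/false]_(x <- s) c (rem x s).
Proof.
case: s => [|x0 s']; first by rewrite big_nil.
move: (x0 :: s') => s cP; rewrite seq_delta_sum (big_nth x0) big_mkord.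
apply: eq_bigr => k _; apply: cP; rewrite -(perm_cons (nth x0 s k)).
apply: (@perm_trans _ s); last by rewrite perm_to_rem // mem_nth.
rewrite perm_sym -{1}(cat_take_drop k s) (drop_nth x0) // -cat1s perm_catCA.
exact: perm_refl.
Qed.

Lemma not_uniq_perm s : ~~ uniq s -> exists x t, perm_eq s [:: x, x & t].
Proof.
elim: s => //= y s IH; rewrite negb_and negbK.
have [ys _|ys /= /IH[x [t st]]] := boolP (y \in s).
  by exists y, (rem y s); rewrite perm_cons perm_to_rem.
exists x, (y :: t); rewrite (perm_trans (y := y :: [:: x, x & t])) ?perm_cons //.
exact/permPl/(perm_catCA [:: y] [:: x; x] t).
Qed.

(** In a list with a repetition, the two faces that remove one of the equal vertices
cancel, and all others still contain the repetition. *)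
Lemma symmetric_seq_delta c : symmetric_cochain c -> symmetric_cochain (seq_delta c).
Proof.
move=> [cP c0].
have dP s t : perm_eq s t -> seq_delta c s = seq_delta c t.
  move=> st; rewrite !seq_delta_rem // (perm_big _ st) /=; apply: eq_big_seq => x xt.
  apply: cP; rewrite -(perm_cons x).
  apply: perm_trans (perm_to_rem xt); apply: (perm_trans _ st).
  by rewrite perm_sym perm_to_rem // (perm_mem st).
split=> // s /not_uniq_perm[x [t /dP ->]].
rewrite /= addbA addbb addFb seq_delta_sum big1 // => k _.
by apply: c0; rewrite /= mem_head.
Qed.

Lemma symmetric_add c c' : symmetric_cochain c -> symmetric_cochain c' ->
  symmetric_cochain (fun s => c s (+) c' s).
Proof.
move=> [cP c0] [cP' c0']; split=> [s t st|s sn]; first by rewrite (cP s t) ?(cP' s t).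
by rewrite c0 ?c0'.
Qed.

End Symmetric.

Lemma symmetric_map (T T' : eqType) (h : T -> T') (c : seq T' -> bool) :
  symmetric_cochain c -> symmetric_cochain (c \o map h).
Proof.
move=> [cP c0]; split=> [s t st|s] /=; first exact/cP/perm_map.
by move=> /(contra (@map_uniq _ _ h s))/c0.
Qed.

End ListCochains.

Section Alternating.
Variables (d : Order.disp_t) (J : porderType d).

Lemma increasing_sorted p (a : 'I_p -> J) :
  increasing a = sorted <%O [seq a i | i <- enum 'I_p].
Proof.
have nthE (i : 'I_p) x0 : nth x0 [seq a i | i <- enum 'I_p] i = a i.
  by rewrite (nth_map i) ?size_enum_ord // nth_ord_enum.
apply/forallP/idP => [ainc|].
  case: p a ainc nthE => [|p] a ainc nthE; first by case: (enum 'I_0) (size_enum_ord 0).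
  rewrite (sorted_pairwise lt_trans); apply/(pairwiseP (a ord0)) => i j.
  rewrite !inE size_map size_enum_ord => ip jp ij.
  rewrite (nthE (Ordinal ip)) (nthE (Ordinal jp)).
  by move/forallP: (ainc (Ordinal ip)) => /(_ (Ordinal jp)); rewrite /= ij.
move=> asort i; apply/forallP => j; apply/implyP => ij.
move: asort; rewrite (sorted_pairwise lt_trans) => /(pairwiseP (a i)) h.
by have := h i j; rewrite !nthE !inE size_map size_enum_ord !ltn_ord; apply.
Qed.

Lemma enum_map_inj p (a b : 'I_p -> J) :
  [seq a i | i <- enum 'I_p] = [seq b i | i <- enum 'I_p] -> a = b.
Proof.
by move=> /eq_in_map ab; apply: functional_extensionality_dep => i; apply: ab; rewrite mem_enum.
Qed.

(** A finite set of indices has at most one increasing enumeration, so the choice made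
in the alternating extension of a cochain does not matter. *)
Lemma increasing_uniq p (a b : 'I_p -> J) : increasing a -> increasing b ->
  perm_eq [seq a i | i <- enum 'I_p] [seq b i | i <- enum 'I_p] -> a = b.
Proof.
rewrite !increasing_sorted => ainc binc /perm_mem ab.
exact/enum_map_inj/lt_sorted_eq.
Qed.

Definition of_seq (p : nat) (s : seq J) (h : size s == p) : 'I_p -> J := tnth (Tuple h).

Lemma of_seqK p (s : seq J) (h : size s == p) :
  [seq of_seq h i | i <- enum 'I_p] = s.
Proof. by rewrite /of_seq map_tnth_enum. Qed.

Lemma perm_enum_map p (a : 'I_p -> J) (s : 'S_p) :
  perm_eq [seq (a \o s) i | i <- enum 'I_p] [seq a i | i <- enum 'I_p].
Proof.
rewrite (map_comp a s); apply: perm_map.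
apply: uniq_perm; rewrite ?(map_inj_uniq perm_inj) ?enum_uniq // => i.
by rewrite mem_enum; apply/mapP; exists ((s^-1)%g i); rewrite ?mem_enum ?permKV.
Qed.

Lemma perm_enum_mapE p (a b : 'I_p -> J) :
  perm_eq [seq b i | i <- enum 'I_p] [seq a i | i <- enum 'I_p] ->
  exists s : 'S_p, b = a \o s.
Proof.
have sz (c : 'I_p -> J) : size [seq c i | i <- enum 'I_p] == p.
  by rewrite size_map size_enum_ord.
rewrite -[X in perm_eq _ X]/(tval (Tuple (sz a))) => /tuple_permP[s bE].
exists s; apply: enum_map_inj; rewrite bE; apply: eq_map => i /=.
by rewrite (tnth_nth (a i)) /= (nth_map i) ?size_enum_ord // nth_ord_enum.
Qed.

(** A function on lists of all lengths, to which the recursions for the coboundary and the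
prism apply. *)
Definition seq_alt p (f : cochain J p) (s : seq J) : bool :=
  if insub s is Some t then Defs.alternating f (tnth (t : p.+1.-tuple J)) else false.

Lemma seq_alt_enum_map p (f : cochain J p) (a : 'I_p.+1 -> J) :
  seq_alt f [seq a i | i <- enum 'I_p.+1] = Defs.alternating f a.
Proof.
rewrite /seq_alt; case: insubP => [t _ tE|]; last by rewrite size_map size_enum_ord eqxx.
by congr (Defs.alternating f _); apply: enum_map_inj; rewrite map_tnth_enum.
Qed.

Lemma seq_alt_size p (f : cochain J p) s : size s != p.+1 -> seq_alt f s = false.
Proof. by rewrite /seq_alt => /negbTE sn; rewrite insubF. Qed.

Lemma seq_alt_cases p (f : cochain J p) s :
  (exists b : 'I_p.+1 -> J, [/\ increasing b,
     perm_eq [seq b i | i <- enum 'I_p.+1] s & seq_alt f s = f b]) \/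
  (forall b : 'I_p.+1 -> J, increasing b ->
     ~~ perm_eq [seq b i | i <- enum 'I_p.+1] s) /\ seq_alt f s = false.
Proof.
have [h|sn] := boolP (size s == p.+1); last first.
  right; split; last exact: seq_alt_size.
  by move=> b _; apply: contra sn => /perm_size <-; rewrite size_map size_enum_ord.
rewrite -[s](of_seqK h) seq_alt_enum_map; move: (of_seq h) => a.
rewrite /Defs.alternating; case: pickP => [t tinc|none].
  by left; exists (a \o t); split=> //; exact: perm_enum_map.
right; split=> // b binc; apply/negP => /perm_enum_mapE[t bE].
by have := none t; rewrite -bE binc.
Qed.

Lemma symmetric_seq_alt p (f : cochain J p) : symmetric_cochain (seq_alt f).
Proof.
split=> [s t st|s].
  have [[b [binc bs ->]]|[nos ->]] := seq_alt_cases f s;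
    have [[b' [b'inc b't ->]]|[not ->]] := seq_alt_cases f t => //.
  - congr (f _); apply: increasing_uniq => //.
    by rewrite (perm_trans bs) // (perm_trans st) // perm_sym.
  - by have := not b binc; rewrite (perm_trans bs st).
  - by have := nos b' b'inc; rewrite (perm_trans b't) // perm_sym.
have [[b [binc bs ->]]|[_ ->]//] := seq_alt_cases f s.
rewrite -(perm_uniq bs); move: binc; rewrite increasing_sorted => /lt_sorted_uniq.
by move=> ->.
Qed.

Lemma seq_alt_increasing p (f : cochain J p) (a : 'I_p.+1 -> J) :
  increasing a -> seq_alt f [seq a i | i <- enum 'I_p.+1] = f a.
Proof.
move=> ainc; have [[b [binc ba ->]]|[/(_ a ainc)]] := seq_alt_cases f [seq a i | i <- enum 'I_p.+1].
  by rewrite (increasing_uniq binc ainc).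
by rewrite perm_refl.
Qed.

Lemma enum_map_lift p (a : 'I_p.+1 -> J) (k : 'I_p.+1) :
  [seq (a \o lift k) i | i <- enum 'I_p] =
  take k [seq a i | i <- enum 'I_p.+1] ++ drop k.+1 [seq a i | i <- enum 'I_p.+1].
Proof.
have sz (q : nat) (b : 'I_q -> J) : size [seq b i | i <- enum 'I_q] = q.
  by rewrite size_map size_enum_ord.
have nthE q (b : 'I_q -> J) x0 (i : 'I_q) : nth x0 [seq b i | i <- enum 'I_q] i = b i.
  by rewrite (nth_map i) ?size_enum_ord // nth_ord_enum.
apply: (@eq_from_nth _ (a k)).
  by rewrite sz size_cat size_take size_drop !sz ltn_ord subSS subnKC // -ltnS.
move=> i; rewrite sz => ip; rewrite (nthE _ _ _ (Ordinal ip)) /=.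
rewrite nth_cat size_take sz ltn_ord; case: ltnP => ik.
  rewrite nth_take // -(nthE _ a (a k) (lift k (Ordinal ip))) /= /bump.
  by rewrite leqNgt ik.
rewrite nth_drop -(nthE _ a (a k) (lift k (Ordinal ip))) /= /bump ik.
by rewrite addSn subnKC // add1n.
Qed.

Lemma increasing_lift p (a : 'I_p.+1 -> J) k : increasing a -> increasing (a \o lift k).
Proof.
rewrite !increasing_sorted enum_map_lift; apply: (subseq_sorted lt_trans).
rewrite -{3}(cat_take_drop k [seq a i | i <- enum 'I_p.+1]).
apply: cat_subseq => //; rewrite -addn1 addnC -drop_drop.
exact: drop_subseq.
Qed.

Lemma coboundary_seq_delta p (c : seq J -> bool) (a : 'I_p.+2 -> J) :
  coboundary (fun b : 'I_p.+1 -> J => c [seq b i | i <- enum 'I_p.+1]) a =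
  seq_delta c [seq a i | i <- enum 'I_p.+2].
Proof.
rewrite seq_delta_sum size_map size_enum_ord; apply: eq_bigr => k _.
by rewrite enum_map_lift.
Qed.

(** The faces of an increasing simplex are increasing, and there the alternating
extension has the original values. *)
Lemma seq_alt_coboundary p (f : cochain J p) (a : 'I_p.+2 -> J) : increasing a ->
  seq_delta (seq_alt f) [seq a i | i <- enum 'I_p.+2] = coboundary f a.
Proof.
move=> ainc; rewrite -coboundary_seq_delta; apply: eq_bigr => k _.
by rewrite seq_alt_increasing // increasing_lift.
Qed.

Lemma comparable_sort p (s : seq J) : size s = p -> uniq s ->
  {in s &, forall a b, (a >=< b)%O} ->
  exists2 a : 'I_p -> J, increasing a & perm_eq [seq a i | i <- enum 'I_p] s.
Proof.
move=> sp su sc; have h : size (sort <=%O s) == p by rewrite size_sort sp.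
exists (of_seq h); last by rewrite of_seqK perm_sort.
rewrite increasing_sorted of_seqK lt_sorted_uniq_le sort_uniq su /=.
by apply: (sort_sorted_in (P := mem s)); [move=> x y xs ys; exact: sc|apply/allP].
Qed.

(** A list without repetitions of pairwise comparable indices can be sorted, so symmetric
cochains are determined by their values on increasing simplices. *)
Lemma symmetric_ext_on (P : J -> Prop) (c c' : seq J -> bool) p :
  symmetric_cochain c -> symmetric_cochain c' ->
  (forall a : 'I_p -> J, increasing a -> (forall i, P (a i)) ->
    c [seq a i | i <- enum 'I_p] = c' [seq a i | i <- enum 'I_p]) ->
  forall s, size s = p -> {in s &, forall a b, (a >=< b)%O} ->
    (forall u, u \in s -> P u) -> c s = c' s.
Proof.
move=> [cP c0] [cP' c0'] cc' s sp scomp sP.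
have [su|sn] := boolP (uniq s); last by rewrite c0 ?c0'.
have [a ainc asort] := comparable_sort sp su scomp.
rewrite -(cP _ _ asort) -(cP' _ _ asort); apply: cc' => // i.
by apply: (sP (a i)); rewrite -(perm_mem asort) map_f // mem_enum.
Qed.

Lemma seq_alt_eq p (f f' : cochain J p) s :
  (forall b : 'I_p.+1 -> J, increasing b -> (forall i, b i \in s) -> f b = f' b) ->
  seq_alt f s = seq_alt f' s.
Proof.
move=> ff'; have [[b [binc bs ->]]|[nos ->]] := seq_alt_cases f s.
  rewrite ff' // => [|i]; last by rewrite -(perm_mem bs) map_f // mem_enum.
  by rewrite -(proj1 (symmetric_seq_alt f') _ _ bs) seq_alt_increasing.
have [[b [binc bs _]]|[_ ->//]] := seq_alt_cases f' s.
by have := nos b binc; rewrite bs.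
Qed.

End Alternating.

Section Transfer.
Variables (d d' : Order.disp_t) (J : porderType d) (J' : porderType d') (T : Type).
Variables (u : T -> J) (v : T -> J').
Hypothesis uv : forall x y, (u x < u y)%O = (v x < v y)%O.

Lemma increasing_transfer p (b : 'I_p -> T) : increasing (u \o b) = increasing (v \o b).
Proof. by apply: eq_forallb => i; apply: eq_forallb => j; rewrite /= uv. Qed.

(** The two induced strict orders agree, so the same permutation sorts both lists. *)
Lemma seq_alt_transfer p (f : cochain J p) (f' : cochain J' p) :
  (forall b : 'I_p.+1 -> T, increasing (u \o b) -> f (u \o b) = f' (v \o b)) ->
  forall t, seq_alt f (map u t) = seq_alt f' (map v t).
Proof.
move=> ff' t; have [tp|tp] := boolP (size t == p.+1); last by rewrite !seq_alt_size ?size_map.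
pose b := tnth (Tuple tp).
have mapE U (w : T -> U) : map w t = [seq (w \o b) i | i <- enum 'I_p.+1].
  by rewrite (map_comp w b) /b map_tnth_enum.
rewrite !mapE.
have [[c [cinc /perm_enum_mapE[s cE] ->]]|[nou ->]] :=
  seq_alt_cases f [seq (u \o b) i | i <- enum 'I_p.+1].
  rewrite cE -compA in cinc *; rewrite ff' //.
  rewrite -(proj1 (symmetric_seq_alt f') _ _ (perm_enum_map (v \o b) s)).
  by rewrite seq_alt_increasing // -compA -increasing_transfer.
have [[c [cinc /perm_enum_mapE[s cE] _]]|[_ -> //]] :=
  seq_alt_cases f' [seq (v \o b) i | i <- enum 'I_p.+1].
have /nou : increasing (u \o (b \o s)) by rewrite increasing_transfer compA -cE.
by rewrite compA perm_enum_map.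
Qed.

End Transfer.

(** * Ordered covers and classes of cocycles *)

Section LexiOrder.
Variables (K : choiceType) (d : Order.disp_t) (J : porderType d).
Variables (rho : K -> J) (r : rel K) (rP : wochoice.total_order r).

Definition lexi_le x y := (rho x < rho y)%O || ((rho x == rho y) && r x y).

Lemma lexi_refl : reflexive lexi_le.
Proof. by move=> x; case: rP => [[[rr _] _] _]; rewrite /lexi_le eqxx rr orbT. Qed.

Lemma lexi_anti : antisymmetric lexi_le.
Proof.
move=> x y /andP[/orP[xy|/andP[/eqP xy rxy]] /orP[yx|/andP[/eqP yx ryx]]].
- by have := lt_trans xy yx; rewrite ltxx.
- by move: xy; rewrite yx ltxx.
- by move: yx; rewrite xy ltxx.
- by case: rP => [[_ ra] _]; apply: ra; rewrite rxy.
Qed.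

Lemma lexi_trans : transitive lexi_le.
Proof.
move=> y x z /orP[xy|/andP[/eqP xy rxy]] /orP[yz|/andP[/eqP yz ryz]].
- by rewrite /lexi_le (lt_trans xy yz).
- by rewrite /lexi_le -yz xy.
- by rewrite /lexi_le xy yz.
- case: rP => [[[_ rt] _] _].
  by rewrite /lexi_le xy yz eqxx (rt _ _ _ rxy ryz) orbT.
Qed.

(** Ordering by [rho] first makes [rho] weakly monotone; since the ties are broken by a
total order, two elements are comparable as soon as their images are. *)
Definition lexi of K -> J & wochoice.total_order r : Type := K.

HB.instance Definition _ := Choice.copy (lexi rho rP) K.
HB.instance Definition _ :=
  Order.Le_isPOrder.Build d (lexi rho rP) lexi_refl lexi_anti lexi_trans.

Lemma lexi_leE (x y : lexi rho rP) : (x <= y)%O = lexi_le x y.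
Proof. by []. Qed.

Lemma lexi_ltE (x y : lexi rho rP) : (x < y)%O = (y != x :> K) && lexi_le x y.
Proof. by rewrite lt_neqAle eq_sym. Qed.

Lemma lexi_homo (x y : lexi rho rP) : (x <= y)%O -> (rho x <= rho y)%O.
Proof. by rewrite lexi_leE => /orP[/ltW|/andP[/eqP ->]]. Qed.

Lemma lexi_comparable (x y : lexi rho rP) : (rho x >=< rho y)%O -> (x >=< y)%O.
Proof.
have rt : total r by case: rP.
rewrite /Order.comparable !lexi_leE /lexi_le !le_eqVlt.
case: (eqVneq (rho x) (rho y)) => [->|] /=; last by move=> _ /orP[] ->; rewrite ?orbT.
by rewrite ltxx /= rt.
Qed.

End LexiOrder.

Lemma total_order_exists (T : eqType) : exists r : rel T, wochoice.total_order r.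
Proof.
have [r rwo] := wochoice.well_ordering_principle T; exists r.
have rch : wochoice.wo_chain r (mem predT) by move=> A _; exact: rwo.
have rtot x y : r x y || r y x by exact: (wochoice.wo_chainW rch).
have rr x : r x x by have := rtot x x; rewrite orbb.
have ra x y : r x y && r y x -> x = y by exact: (wochoice.wo_chain_antisymmetric rch).
split; last exact: rtot.
split; last exact: ra.
split; first exact: rr.
move=> y x z xy yz.
have [m [[mA mle] _]] := rwo (mem [:: x; y; z]) (ex_intro _ x (mem_head _ _)).
have [mx my mz] : [/\ r m x, r m y & r m z].
  by split; apply: mle; rewrite !inE eqxx ?orbT.
move: mA; rewrite !inE => /or3P[] /eqP mE; first by rewrite -mE.
  by rewrite mE in mx; rewrite (ra x y) ?xy.
by rewrite mE in my; rewrite -(ra y z) ?yz.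
Qed.

Section Covers.
Variables (M : topologicalType) (S : set M).
Implicit Types U W : ordered_cover S.

Definition common U (s : seq (idx U)) := exists x, forall u, u \in s -> U u x.

Lemma common_sub U (s t : seq (idx U)) : {subset t <= s} -> common s -> common t.
Proof. by move=> ts [x xs]; exists x => u /ts /xs. Qed.

Lemma common_refinement U W (rho : idx W -> idx U) s :
  refinement rho -> common s -> common (map rho s).
Proof. by move=> rhoP [x xs]; exists x => _ /mapP[w ws ->]; apply/rhoP/xs. Qed.

Lemma common_simplex U p (a : 'I_p.+1 -> idx U) :
  simplex a -> common [seq a i | i <- enum 'I_p.+1].
Proof. by case=> _ [x ax]; exists x => _ /mapP[i _ ->]; exact: ax. Qed.

Lemma common_comparable U (s : seq (idx U)) :
  common s -> {in s &, forall a b, (a >=< b)%O}.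
Proof. by case=> x xs; apply: cset_total; exists x => a /= /xs. Qed.

Lemma symmetric_ext U (c c' : seq (idx U) -> bool) p :
  symmetric_cochain c -> symmetric_cochain c' ->
  (forall a : 'I_p.+1 -> idx U, simplex a ->
    c [seq a i | i <- enum 'I_p.+1] = c' [seq a i | i <- enum 'I_p.+1]) ->
  forall s, size s = p.+1 -> common s -> c s = c' s.
Proof.
move=> cS cS' cc' s sp scom; have [x xs] := scom.
apply: (symmetric_ext_on (P := fun u => U u x) cS cS' _ sp (common_comparable scom)) => //.
by move=> a ainc ax; apply: cc'; split=> //; exists x.
Qed.

Lemma cocycle_seq_alt U p (f : cochain (idx U) p) : cocycle f ->
  forall s, size s = p.+2 -> common s -> seq_delta (seq_alt f) s = false.
Proof.
move=> fP s sp scom.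
apply: (symmetric_ext (c' := fun=> false) _ _ _ sp scom).
- exact/symmetric_seq_delta/symmetric_seq_alt.
- by split.
- by move=> a [ainc ane]; rewrite seq_alt_coboundary // fP.
Qed.

Lemma pullback_seq_alt U (K : Type) (rho : K -> idx U) p (f : cochain (idx U) p) a :
  pullback rho f a = seq_alt f (map rho [seq a i | i <- enum 'I_p.+1]).
Proof. by rewrite -map_comp; exact/esym/seq_alt_enum_map. Qed.

Lemma same_class_intro U U' p (f : cochain (idx U) p.+1) (f' : cochain (idx U') p.+1)
    (W : ordered_cover S) (rho : idx W -> idx U) (rho' : idx W -> idx U')
    (c : seq (idx W) -> bool) :
  refinement rho -> refinement rho' ->
  (forall s, size s = p.+2 -> common s ->
    seq_alt f (map rho s) (+) seq_alt f' (map rho' s) = seq_delta c s) ->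
  same_class f f'.
Proof.
move=> rhoP rhoP' H.
exists W, rho, rho', (fun b : 'I_p.+1 -> idx W => c [seq b i | i <- enum 'I_p.+1]).
split=> // a aP; rewrite coboundary_seq_delta !pullback_seq_alt H //.
  by rewrite size_map size_enum_ord.
exact: common_simplex.
Qed.

(** An equality of classes, known on increasing simplices, holds for all lists of indices
with a common point. *)
Lemma same_class_elim U U' p (f : cochain (idx U) p.+1) (f' : cochain (idx U') p.+1) :
  same_class f f' ->
  exists (W : ordered_cover S) (rho : idx W -> idx U) (rho' : idx W -> idx U')
    (c : seq (idx W) -> bool),
    [/\ refinement rho, refinement rho', symmetric_cochain c &
      forall s, size s = p.+2 -> common s ->
        seq_alt f (map rho s) (+) seq_alt f' (map rho' s) = seq_delta c s].
Proof.
move=> [W [rho [rho' [g [rhoP rhoP' H]]]]].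
exists W, rho, rho', (seq_alt g); split=> //; first exact: symmetric_seq_alt.
apply: symmetric_ext.
- by apply: symmetric_add; apply: symmetric_map; exact: symmetric_seq_alt.
- exact/symmetric_seq_delta/symmetric_seq_alt.
- by move=> a aP; rewrite seq_alt_coboundary; [rewrite -H // !pullback_seq_alt|case: aP].
Qed.

Lemma seq_alt_false U p s : seq_alt (fun _ : 'I_p.+1 -> idx U => false) s = false.
Proof.
by have [[b [_ _ ->]]|[_ ->]] := seq_alt_cases (fun _ : 'I_p.+1 -> idx U => false) s.
Qed.

Lemma prism_vanish (T : eqType) (c : seq T -> bool) s :
  (forall t, size t = (size s).+1 -> {subset t <= unzip1 s ++ unzip2 s} -> c t = false) ->
  prism c s = false.
Proof.
elim: s c => //= -[x y] s IH c c0 /=; rewrite c0 ?IH //=.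
- move=> t ts tsub; apply: c0; rewrite /= ?ts // => z; rewrite !inE => /predU1P[->|/tsub].
    by rewrite eqxx.
  by rewrite !mem_cat inE => /orP[] ->; rewrite !orbT.
- by rewrite size_map.
- by move=> z; rewrite !inE mem_cat inE => /or3P[] ->; rewrite ?orbT.
Qed.

(** The vertices of the prism have a common point, so the cocycle condition applies to all
its simplices, and only the two ends contribute. *)
Lemma cocycle_prism U p (f : cochain (idx U) p) s : cocycle f ->
  size s = p.+1 -> common (unzip1 s ++ unzip2 s) ->
  seq_delta (prism (seq_alt f)) s = seq_alt f (unzip1 s) (+) seq_alt f (unzip2 s).
Proof.
move=> fP sp scom; rewrite -prism_homotopy [X in _ = _ (+) X]prism_vanish ?addbF //.
by move=> t tp ts; apply: cocycle_seq_alt => //; [rewrite tp sp|exact: common_sub scom].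
Qed.

Section LexiCover.
Variables (K : choiceType) (d : Order.disp_t) (J : porderType d).
Variables (rho : K -> J) (r : rel K) (rP : wochoice.total_order r).
Variable C : K -> set M.
Hypothesis C_open : forall k, exists2 O, open O & C k = O `&` S.
Hypothesis C_cover : \bigcup_k C k = S.
Hypothesis C_total : forall k l, C k `&` C l !=set0 -> (rho k >=< rho l)%O.

Lemma lexi_cover_total (s : seq (lexi rho rP)) : \bigcap_(a in [set` s]) C a !=set0 ->
  {in s &, forall a b, (a >=< b)%O}.
Proof.
move=> [x xs] a b /xs ax /xs bx; apply: lexi_comparable; apply: C_total.
by exists x.
Qed.

Definition lexi_cover : ordered_cover S :=
  @OrderedCover M S d (lexi rho rP) C C_open C_cover lexi_cover_total.

End LexiCover.

(** An ordered cover asks for an order on the index set; any total order will do. *)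
Lemma cover_exists (K : choiceType) (C : K -> set M) :
  (forall k, exists2 O, open O & C k = O `&` S) -> \bigcup_k C k = S ->
  exists (W : ordered_cover S) (h : idx W -> K), forall w, W w = C (h w).
Proof.
move=> Cop Ccov; have [r rP] := total_order_exists K.
have tot (k l : K) : C k `&` C l !=set0 -> (true >=< true)%O by [].
by exists (lexi_cover (rho := fun _ => true) rP Cop Ccov tot), id.
Qed.

(** On the common refinement of the two refinements there are two refinement maps into
the cover of [f'], one through each of them; the prism between them compensates for
their difference. *)
Lemma same_class_trans (U U' U'' : ordered_cover S) p (f : cochain (idx U) p.+1)
    (f' : cochain (idx U') p.+1) (f'' : cochain (idx U'') p.+1) :
  cocycle f' -> same_class f f' -> same_class f' f'' -> same_class f f''.
Proof.
move=> f'P /same_class_elim[W1 [r1 [r1' [c1 [r1P r1P' _ H1]]]]].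
move=> /same_class_elim[W2 [r2 [r2' [c2 [r2P r2P' _ H2]]]]].
pose C (k : idx W1 * idx W2) := W1 k.1 `&` W2 k.2.
have Cop k : exists2 O, open O & C k = O `&` S.
  have [Q1 Q1o W1E] := cset_open k.1; have [Q2 Q2o W2E] := cset_open k.2.
  exists (Q1 `&` Q2); first exact: openI.
  by rewrite /C W1E W2E setIACA setIid.
have Ccov : \bigcup_k C k = S.
  apply/seteqP; split=> [x [k _ [xk _]]|x Sx].
    by rewrite -(cset_cover W1); exists k.1.
  have : (\bigcup_(a in setT) W1 a) x by rewrite cset_cover.
  move=> [w1 _ xw1]; have : (\bigcup_a W2 a) x by rewrite cset_cover.
  by move=> [w2 _ xw2]; exists (w1, w2).
have [W [h hE]] := cover_exists Cop Ccov.
have hP1 : refinement (fst \o h) by move=> w x; rewrite hE => -[].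
have hP2 : refinement (snd \o h) by move=> w x; rewrite hE => -[].
pose q w := (r1' (h w).1, r2 (h w).2).
apply: (same_class_intro (W := W) (rho := r1 \o (fst \o h)) (rho' := r2' \o (snd \o h))
  (c := fun s => c1 (map (fst \o h) s) (+) prism (seq_alt f') (map q s)
                  (+) c2 (map (snd \o h) s))).
- by move=> w x /hP1 /r1P.
- by move=> w x /hP2 /r2P'.
move=> s sp scom; rewrite 2!seq_delta_add (seq_delta_map _ c1) (seq_delta_map _ c2).
rewrite (seq_delta_map q (prism (seq_alt f'))) -H1 ?size_map //; last exact: common_refinement.
rewrite -H2 ?size_map //; last exact: common_refinement.
rewrite cocycle_prism ?size_map // /unzip1 /unzip2 -?map_comp.
  have -> : [seq (fst \o q) i | i <- s] = [seq r1' i | i <- [seq (fst \o h) i | i <- s]].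
    by rewrite -map_comp.
  have -> : [seq (snd \o q) i | i <- s] = [seq r2 i | i <- [seq (snd \o h) i | i <- s]].
    by rewrite -map_comp.
  by case: (seq_alt f _) (seq_alt f'' _) (seq_alt f' _) (seq_alt f' _) => [] [] [] [].
by case: scom => x xs; exists x => u; rewrite mem_cat => /orP[] /mapP[w ws ->];
  have := xs w ws; rewrite hE => -[? ?]; [exact: r1P'|exact: r2P].
Qed.

(** The zero cochain pulls back to zero, whatever cover it is given on. *)
Lemma same_class_zero (U U' : ordered_cover S) p (f : cochain (idx U) p.+1)
    (f' : cochain (idx U') p.+1) :
  cocycle f' -> same_class f f' -> zero_class f' -> zero_class f.
Proof.
move=> f'P ff' f'0.
have [W [rho [rho' [c [rhoP _ _ H]]]]] := same_class_elim (same_class_trans f'P ff' f'0).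
apply: (same_class_intro rhoP rhoP (c := c)) => s sp scom.
by rewrite -H // !seq_alt_false.
Qed.

End Covers.

(** * Homotopy invariance *)

Section Tube.
Variables (R : realType) (M : topologicalType) (H : ordered_cover (cylinder R M)).

(** The Lebesgue number argument, with a neighbourhood of [x] as an extra parameter: the
segment over [x] is compact, so that [x] has a neighbourhood [T.1.1] over which each
interval of the dyadic subdivision of level [T.1.2] lies in one member of the cover. *)
Lemma tube (x : M) : exists (T : set M * nat * (nat -> idx H)),
  [/\ open T.1.1, T.1.1 x &
    forall i y (t : R), (i < 2 ^ T.1.2)%N -> T.1.1 y ->
      i%:R / 2 ^+ T.1.2 <= t <= i.+1%:R / 2 ^+ T.1.2 -> H (T.2 i) (y, t)].
Proof.
pose P (Nm : set M * nat) (t : R) := exists a, forall y (t' : R), Nm.1 y -> 0 <= t' <= 1 ->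
  `|t' - t| <= (2 ^+ Nm.2)^-1 -> H a (y, t').
pose F := filter_prod (powerset_filter_from (nbhs x)) \oo.
have PF : ProperFilter F by exact: filter_prod_proper.
have cover (t : R) : `[0, 1]%classic t -> \forall t' \near t & i \near F, P i t'.
  rewrite /= in_itv /= => t01.
  have : (\bigcup_(a in setT) H a) (x, t) by rewrite cset_cover /cylinder /= in_itv.
  move=> [a _ Ha]; have [Q Qo HE] := cset_open a.
  have [Qxt _] : (Q `&` cylinder R M) (x, t) by rewrite -HE.
  have [[/= N B] [Nx Bt] NBQ] : nbhs (x, t) Q by exact: open_nbhs_nbhs.
  have [e /= e0 eB] := (nbhs_ballP _ _).1 Bt.
  have e20 : 0 < e / 2 by rewrite divr_gt0.
  exists (ball t (e / 2), [set Nm : set M * nat | Nm.1 `<=` N /\ 1 / 2 ^+ Nm.2 < e / 2]).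
    split; first exact: nbhsx_ballx.
    exists ([set N' | N' `<=` N], [set m | 1 / 2 ^+ m < e / 2]).
      split; first exact: small_set_sub.
      exact: (near_infty_natSinv_expn_lt (PosNum e20)).
    by move=> [N' m] /= [].
  move=> [t' [N' m]] /= [tt' [NN' me]]; exists a => y t'' /= N'y t''01 t''t'.
  rewrite HE; split; last by rewrite /cylinder /= in_itv.
  apply: (NBQ (y, t'')); split=> /=; first exact: NN'.
  apply: eB; rewrite /ball /= -[t - t''](subrKA t').
  apply: le_lt_trans (ler_normD _ _) _; rewrite [e]splitr; apply: ltrD => //.
  by rewrite distrC (le_lt_trans t''t') // -div1r.
have FF : Filter F by exact: PF.
have covF := (compact_near_coveringP _).1 (@segment_compact R 0 1) _ F P FF cover.
have smallF : \forall Nm \near F, nbhs x Nm.1.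
  exists ([set N' | nbhs x N'], setT); last by move=> [N' m] [].
  by split; [exact: near_small_set|exact: filterT].
have [[N m] /= [Nx Pm]] := filter_ex (filterI smallF covF).
have m0 : 0 < 2 ^+ m :> R by rewrite exprn_gt0.
have in01 i : (i < 2 ^ m)%N -> `[0, 1]%classic (i%:R / 2 ^+ m : R).
  move=> im; rewrite /= in_itv /=; apply/andP; split.
    by apply: divr_ge0; rewrite ?ler0n // ltW.
  by rewrite ler_pdivrMr // mul1r -natrX ler_nat ltnW.
have /choice[a aP] i : exists a : idx H, (i < 2 ^ m)%N ->
    forall y (t' : R), N y -> 0 <= t' <= 1 ->
      `|t' - i%:R / 2 ^+ m| <= (2 ^+ m)^-1 -> H a (y, t').
  have [im|im] := ltnP i (2 ^ m).
    by have [a aP] := Pm _ (in01 i im); exists a.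
  by have [a _] := Pm _ (in01 0 (expn_gt0 2 m)); exists a.
exists (N^°, m, a); split=> /=; first exact: open_interior.
  exact: nbhs_singleton (nbhs_interior Nx).
move=> i y t im /interior_subset Ny /andP[it ti].
apply: aP => //.
  apply/andP; split; first by apply: le_trans it; apply: divr_ge0; rewrite ?ler0n // ltW.
  by rewrite (le_trans ti) // ler_pdivrMr // mul1r -natrX ler_nat.
rewrite ger0_norm ?subr_ge0 // lerBlDr (le_trans ti) //.
by rewrite -natr1 mulrDl mul1r addrC.
Qed.

End Tube.

Section Telescope.

Lemma seq_delta_bigsum T N (F : 'I_N -> seq T -> bool) s :
  seq_delta (fun t => \big[addb/false]_(i < N) F i t) s =
  \big[addb/false]_(i < N) seq_delta (F i) s.
Proof.
elim: N F => [|N IH] F.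
  rewrite big_ord0 (@seq_delta_eq _ _ (fun=> false)) => [|t]; last by rewrite big_ord0.
  by rewrite seq_delta_sum big1.
rewrite big_ord_recr /= -IH -seq_delta_add; apply: seq_delta_eq => t.
by rewrite big_ord_recr.
Qed.

Lemma addb_telescope N (b : nat -> bool) :
  \big[addb/false]_(i < N) (b i (+) b i.+1) = b 0%N (+) b N.
Proof.
elim: N => [|N IH]; first by rewrite big_ord0 addbb.
by rewrite big_ord_recr /= IH addbA addbK.
Qed.

Lemma addb_odd_terms k (b : nat -> bool) : (forall i, b i.*2 = false) ->
  \big[addb/false]_(i < k.*2.+1) b i = \big[addb/false]_(i < k) b i.*2.+1.
Proof.
move=> b0; elim: k => [|k IH]; first by rewrite big_ord_recl !big_ord0 (b0 0%N).
by rewrite doubleS big_ord_recr big_ord_recr /= IH [RHS]big_ord_recr /= -doubleS b0 addbF.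
Qed.

End Telescope.

Section Homotopy.
Variables (R : realType) (M : topologicalType) (H : ordered_cover (cylinder R M)).
Variables (p : nat) (f : cochain (idx H) p).

(** The new cover consists of neighbourhoods as in [tube]; [a0] and [a1] choose the members
of [H] that contain the ends of the segments.  The subdivision levels are unbounded on
the base, but the vertices of one simplex have a common refinement of level [m].  Passing
from the dyadic interval [i] to the interval [i + 1] simultaneously for all vertices
changes the cocycle by the coboundary of a prism, because both members of [H] contain
the common end of the two intervals.  The sum [G m] of these prisms over [i] telescopes
to the difference of the two ends.  It is the same for all large [m], because
subdividing only inserts constant steps, whose prisms are degenerate; so [G] defines a
cochain although [m] depends on the simplex. *)
Theorem homotopy_invariance : cocycle f ->
  exists (W : ordered_cover [set: M]) (a0 a1 : idx W -> idx H) (c : seq (idx W) -> bool),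
  [/\ forall w, W w !=set0,
      forall w x, W w x -> H (a0 w) (x, 0) /\ H (a1 w) (x, 1) &
      forall s, size s = p.+1 -> common s ->
        seq_alt f (map a0 s) (+) seq_alt f (map a1 s) = seq_delta c s].
Proof.
move=> fP.
have [T TP] := choice (@tube R M H).
have Cop x : exists2 O, open O & (T x).1.1 = O `&` setT.
  by exists (T x).1.1; [by case: (TP x)|rewrite setIT].
have Ccov : \bigcup_x (T x).1.1 = setT.
  by apply/seteqP; split=> // x _; exists x => //; case: (TP x).
have [W [h hE]] := cover_exists Cop Ccov.
(* [al m i w] is the member of [H] used by [w] on the [i]-th dyadic interval of level [m]. *)
pose lev w := (T (h w)).1.2.
pose al m i w := (T (h w)).2 (i %/ 2 ^ (m - lev w))%N.
have alP m i w y (t : R) : (lev w <= m)%N -> (i < 2 ^ m)%N -> W w y ->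
    i%:R / 2 ^+ m <= t <= i.+1%:R / 2 ^+ m -> H (al m i w) (y, t).
  move=> wm im; rewrite hE => Wy /andP[it ti]; case: (TP (h w)) => _ _; apply=> //.
    by rewrite ltn_divLR ?expn_gt0 // -expnD subnKC.
  rewrite -/(lev w); set q := (2 ^ (m - lev w))%N.
  have q0 : (0 < q)%N by rewrite expn_gt0.
  have dyadic k : k%:R / 2 ^+ lev w = (k * q)%:R / 2 ^+ m :> R.
    rewrite -(subnKC wm) exprD -natrX natrM -mulf_div natrX -/q.
    by rewrite -[2 ^+ (m - _)]natrX divff ?mulr1 // pnatr_eq0 -lt0n.
  rewrite !dyadic; apply/andP; split.
    by apply: le_trans it; rewrite ler_pM2r ?invr_gt0 ?exprn_gt0 // ler_nat leq_divM.
  apply: le_trans ti _; rewrite ler_pM2r ?invr_gt0 ?exprn_gt0 // ler_nat.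
  by rewrite ltn_ceil.
have al2 m i w : (lev w <= m)%N -> al m.+1 i w = al m i./2 w.
  by move=> wm; rewrite /al subSn // expnS divnMA divn2.
pose L := seq_alt f.
pose G m s := \big[addb/false]_(i < (2 ^ m).-1)
  prism L (map (fun w => (al m i w, al m i.+1 w)) s).
(* A step of level [m + 1] with even index stays inside one interval of level [m]. *)
have GS m s : (forall w, w \in s -> (lev w <= m)%N) -> G m.+1 s = G m s.
  move=> sm; have -> : G m.+1 s = \big[addb/false]_(i < (2 ^ m).-1.*2.+1)
      prism L (map (fun w => (al m.+1 i w, al m.+1 i.+1 w)) s).
    rewrite /G expnS mul2n -(prednK (expn_gt0 2 m)) //.
  rewrite (@addb_odd_terms _ (fun i =>
    prism L (map (fun w => (al m.+1 i w, al m.+1 i.+1 w)) s))).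
    apply: eq_bigr => i _; congr prism; apply/eq_in_map => w ws.
    by rewrite !al2 ?sm //= uphalf_double doubleK.
  move=> i; rewrite (_ : map _ s = [seq (u, u) | u <- map (al m i) s]).
    exact/symmetric_prism_diag/symmetric_seq_alt.
  rewrite -map_comp; apply/eq_in_map => w ws.
  by rewrite !al2 ?sm //= uphalf_double doubleK.
pose top s := \max_(w <- s) lev w.
have topP s w : w \in s -> (lev w <= top s)%N by move=> ws; exact: leq_bigmax_seq.
have Gtop m s : (forall w, w \in s -> (lev w <= m)%N) -> G m s = G (top s) s.
  move=> sm; have : (top s <= m)%N by apply/bigmax_leqP_seq => w ws _; exact: sm.
  move/subnKC <-; elim: (m - top s)%N => [|k IH]; first by rewrite addn0.
  by rewrite addnS GS // => w ws; rewrite (leq_trans (topP s w ws)) ?leq_addr.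
have Gdelta s : seq_delta (fun t => G (top t) t) s = seq_delta (G (top s)) s.
  rewrite !seq_delta_sum; apply: eq_bigr => k _; apply/esym/Gtop => w.
  by rewrite mem_cat => /orP[/mem_take|/mem_drop]; exact: topP.
exists W, (fun w => (T (h w)).2 0%N), (fun w => (T (h w)).2 (2 ^ lev w).-1).
exists (fun t => G (top t) t); split.
- by move=> w; exists (h w); rewrite hE; case: (TP (h w)).
- move=> w x Wx; have al0 : al (lev w) 0%N w = (T (h w)).2 0%N by rewrite /al div0n.
  have al1 : al (lev w) (2 ^ lev w).-1 w = (T (h w)).2 (2 ^ lev w).-1.
    by rewrite /al subnn expn0 divn1.
  have pos : (0 < 2 ^ lev w)%N by rewrite expn_gt0.
  have posR : 0 < 2 ^+ lev w :> R by rewrite exprn_gt0.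
  rewrite -al0 -al1; split; apply: alP => //.
  + by rewrite mul0r lexx; apply: divr_ge0; rewrite ?ler0n // ltW.
  + by rewrite prednK.
  + rewrite prednK // natrX divff ?gt_eqF // lexx andbT.
    by rewrite ler_pdivrMr // mul1r -natrX ler_nat leq_pred.
move=> s sp [x xs]; rewrite Gdelta; set m := top s.
have sm w : w \in s -> (lev w <= m)%N := topP s w.
rewrite /G seq_delta_bigsum.
transitivity (\big[addb/false]_(i < (2 ^ m).-1)
  (L (map (al m i) s) (+) L (map (al m i.+1) s))).
  rewrite (addb_telescope _ (fun i => L (map (al m i) s))); congr (L _ (+) L _).
    by apply/eq_in_map => w ws; rewrite /al div0n.
  apply/eq_in_map => w ws; rewrite /al; congr (_ _).
  have q0 : (0 < 2 ^ (m - lev w))%N by rewrite expn_gt0.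
  have -> : ((2 ^ m).-1 = (2 ^ lev w).-1 * 2 ^ (m - lev w) + (2 ^ (m - lev w)).-1)%N.
    rewrite -{1}(subnKC (sm w ws)) expnD.
    move: q0 (expn_gt0 2 (lev w)); move: (2 ^ (m - lev w))%N (2 ^ lev w)%N => [//|q] [//|l] _ _ /=.
    by rewrite addnC.
  by rewrite divnMDl // [X in (_ + X)%N]divn_small ?addn0 // prednK.
apply: eq_bigr => i _; rewrite (seq_delta_map _ (prism L)) cocycle_prism ?size_map //.
  by rewrite /unzip1 /unzip2 -!map_comp.
have im : (i.+1 < 2 ^ m)%N by rewrite -ltn_predRL.
exists (x, i.+1%:R / 2 ^+ m) => u; rewrite mem_cat /unzip1 /unzip2 -!map_comp.
have pos : 0 < (2 ^+ m)^-1 :> R by rewrite invr_gt0 exprn_gt0.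
case/orP => /mapP[w ws ->] /=; apply: alP; rewrite ?sm ?xs // ?lexx ?andbT ?andTb //.
- exact: ltnW.
- exact: xs.
- by rewrite ler_pM2r // ler_nat.
- exact: xs.
- by rewrite ler_pM2r // ler_nat.
Qed.

End Homotopy.

(** * The sign cocycle depends only on the equivalence class *)

Section SignCocycle.
Variables (R : realType) (n : nat).
Variables (M : topologicalType) (V : normedModType R) (A : atlas M V) (S : set M).
Variable E : bundle (GL R n) A S.

Definition sign_cochain : cochain (idx E) 3 :=
  fun a => sgn R[i] (bobj E (a (inord 0)) (a (inord 1)))
                    (bobj E (a (inord 1)) (a (inord 2)))
                    (bobj E (a (inord 2)) (a (inord 3))).

Lemma lift_inord (k : 'I_5) j : (j < 4)%N -> lift k (inord j : 'I_4) = inord (bump k j).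
Proof.
move=> j4; apply: val_inj; rewrite /= !inordK //.
by rewrite /bump; case: (k <= j)%N => /=; rewrite ?add1n ?add0n ?ltnS // leqW.
Qed.

Lemma increasingE p (a : 'I_p.+1 -> idx E) i j : increasing a -> (i < j < p.+1)%N ->
  (a (inord i) < a (inord j))%O.
Proof.
move=> /forallP/(_ (inord i))/forallP/(_ (inord j))/implyP ainc /andP[ij jp].
by apply: ainc; rewrite !inordK // (ltn_trans ij).
Qed.

(** The objects multiply strictly, so the five faces are the signs of the five associators
of the pentagon for the four consecutive objects. *)
Theorem sign_cocycle : cocycle sign_cochain.
Proof.
move=> a [ainc _]; rewrite /coboundary !big_ord_recl big_ord0 /sign_cochain /=.
rewrite !lift_inord //= /bump /= !add0n ?add1n.
have lt i j : (i < j < 5)%N -> (a (inord i) < a (inord j))%O by exact: increasingE.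
have F2 : (2%:R : R[i]) != 0 by rewrite pnatr_eq0.
have := sgn_pentagon F2 (bobj E (a (inord 0)) (a (inord 1)))
  (bobj E (a (inord 1)) (a (inord 2))) (bobj E (a (inord 2)) (a (inord 3)))
  (bobj E (a (inord 3)) (a (inord 4))).
have prodE i j k : (i < j < 5)%N -> (j < k < 5)%N ->
    mprod (bobj E (a (inord i)) (a (inord j))) (bobj E (a (inord j)) (a (inord k))) =
    bobj E (a (inord i)) (a (inord k)).
  by move=> ij jk; rewrite -(bobj_prod (lt _ _ ij) (lt _ _ jk)).
rewrite !prodE //.
by do 5!case: (sgn _ _ _ _).
Qed.

End SignCocycle.

Arguments sign_cochain {R n M V A S} E.

Section Equivalent.
Variables (R : realType) (n : nat).
Variables (M : topologicalType) (V : normedModType R) (A : atlas M V).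

(** The restriction of [H] at [t] has the same objects as [E], and its indices are matched
in an order-preserving way with those of [E]. *)
Lemma restriction_seq_alt (H : bundle (GL R n) (cyl_atlas A) (cylinder R M)) (t : R)
    (E : bundle2 n A) (W : ordered_cover [set: M]) (a : idx W -> idx H) :
  restricts_to H t E -> (forall w, W w !=set0) -> (forall w x, W w x -> H (a w) (x, t)) ->
  exists2 rho : idx W -> idx E, refinement rho &
    forall s, seq_alt (sgn_cochain E) (map rho s) = seq_alt (sign_cochain H) (map a s).
Proof.
move=> [f [[g gK fK] flt fset fobj _]] Wne Wa.
have ne w : slice (H (a w)) t !=set0 by have [x Wx] := Wne w; exists x; exact: Wa.
pose b w : nonempty_idx E := g (exist _ (a w) (ne w)).
have fb w : sval (f (b w)) = a w by rewrite /b fK.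
exists (sval \o b) => [w x Wx /=|s].
  by rewrite -(fset (b w)) fb; exact: Wa.
rewrite (map_comp sval b) -(eq_map fb) (map_comp (sval \o f) b).
apply: seq_alt_transfer => [x y|c cinc]; first by rewrite /= flt.
have lt i j : (i < j < 4)%N -> (sval (c (inord i)) < sval (c (inord j)))%O.
  exact: (increasingE (a := sval \o c)).
by rewrite /sgn_cochain /sign_cochain /= !fobj ?lt.
Qed.

Theorem equivalent_same_class (E0 E1 : bundle2 n A) : equivalent E0 E1 ->
  same_class (sgn_cochain E0) (sgn_cochain E1).
Proof.
move=> [H [H0 H1 _ _]].
have [W [a0 [a1 [c [Wne Wa Wc]]]]] := homotopy_invariance (@sign_cocycle _ _ _ _ _ _ H).
have [rho0 rho0P rho0E] := restriction_seq_alt H0 Wne (fun w x Wx => proj1 (Wa w x Wx)).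
have [rho1 rho1P rho1E] := restriction_seq_alt H1 Wne (fun w x Wx => proj2 (Wa w x Wx)).
by apply: (same_class_intro rho0P rho1P (c := c)) => s sp scom; rewrite rho0E rho1E Wc.
Qed.

End Equivalent.

(** * Smooth functions *)

Section Smooth.
Variable R : realType.

Lemma Ck_subset k (E F : normedModType R) (U U' : set E) (f : E -> F) :
  U' `<=` U -> Ck k U f -> Ck k U' f.
Proof.
elim: k E F U U' f => [|k IH] E F U U' f UU' /= [fc fd]; split=> //.
- by move=> x /UU'/fc.
- by move=> x /UU'/fc.
case: fd => fd fD; split=> [x v /UU'|]; first exact: fd.
by apply: IH fD => -[x v] /= [/UU' Ux _].
Qed.

Lemma Ck_cst k (E F : normedModType R) (U : set E) (y : F) : Ck k U (fun=> y).
Proof.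
elim: k E F U y => [|k IH] E F U y; split=> //; [by move=> x _; exact: cst_continuous..|].
split=> [x v _|]; first exact: derivable_cst.
rewrite (_ : (fun p : E * E => _) = fun=> 0); first exact: IH.
by apply: functional_extensionality_dep => p; exact: derive_cst.
Qed.

(** The derivative of [f \o L] is the derivative of [f] composed with [L] on the point and
on the direction, and that map is again linear and continuous. *)
Lemma Ck_comp_linear k (E' E F : normedModType R) (L : E' -> E) (U : set E) (f : E -> F) :
  (forall (h : R) v x, L (h *: v + x) = h *: L v + L x) -> continuous L ->
  Ck k U f -> Ck k (L @^-1` U) (f \o L).
Proof.
elim: k E' E F L U f => [|k IH] E' E F L U f Llin Lc /= [fc fd].
  by split=> // x Ux; apply: continuous_comp; [exact: Lc|exact: fc].
split=> [x Ux|]; first by apply: continuous_comp; [exact: Lc|exact: fc].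
have quot x v : (fun h : R => h^-1 *: ((f \o L \o shift x) (h *: v) - (f \o L) x)) =
    (fun h : R => h^-1 *: ((f \o shift (L x)) (h *: L v) - f (L x))).
  by apply: functional_extensionality_dep => h /=; rewrite Llin.
case: fd => fd fD; split=> [x v Ux|].
  by rewrite /derivable quot; exact: fd.
pose L2 (p : E' * E') := (L p.1, L p.2).
rewrite (_ : (fun p : E' * E' => _) = (fun p : E * E => 'D_p.2 f p.1) \o L2); last first.
  by apply: functional_extensionality_dep => p; rewrite /derive quot.
apply: (@Ck_subset k _ _ (L2 @^-1` (U `*` setT))) => [[x v] /= [Ux _]//|].
apply: IH fD.
  by move=> h [v1 v2] [x1 x2]; rewrite /L2 /= !Llin.
move=> p; apply: cvg_pair => /=.
- by apply: (@continuous_comp _ _ _ fst L); [exact: cvg_fst|exact: Lc].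
- by apply: (@continuous_comp _ _ _ snd L); [exact: cvg_snd|exact: Lc].
Qed.

Section Atlas.
Variables (M : topologicalType) (V : normedModType R) (A : atlas M V).

Lemma smooth_on_cst (W : set M) (y : R) : smooth_on A W (fun=> y).
Proof.
move=> x _; exists setT, (fun=> y); split=> //; first exact: openT.
by move=> i; exists (fun=> y) => // k; exact: Ck_cst.
Qed.

Lemma smooth_on_subset (W W' : set M) f : W' `<=` W -> smooth_on A W f -> smooth_on A W' f.
Proof.
move=> W'W fW x /W'W /fW[Q [g [Qo Qx Qg fg]]]; exists Q, g; split=> // y.
by rewrite inE => -[Qy /W'W Wy]; apply: fg; rewrite inE.
Qed.

Lemma smooth_on_cyl (W : set M) (W' : set (M * R)) f :
  W' `<=` fst @^-1` W -> smooth_on A W f -> smooth_on (cyl_atlas A) W' (f \o fst).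
Proof.
move=> W'W fW [x t] /W'W /= /fW[Q [g [Qo Qx Qg fg]]].
exists (fst @^-1` Q), (g \o fst); split=> //.
- by apply: open_comp => // p _; exact: cvg_fst.
- move=> i; have [h hC gh] := Qg i; pose pr : (V * R^o)%type -> V := fst.
  exists (h \o pr); last first.
    by move=> p Qp [ip _] /=; rewrite gh.
  move=> k; apply: (@Ck_subset k _ _ (pr @^-1` (chart A i @` (Q `&` Defs.dom A i)))).
    by move=> [v s] /= [[y r] [Qy [iy _]] [<- _]]; exists y.
  by apply: Ck_comp_linear => // p; exact: cvg_fst.
- by move=> [y s]; rewrite inE => -[/= Qy /W'W Wy]; apply: fg; rewrite inE.
Qed.

Hypothesis hA : smooth_atlas A.

Lemma smooth_on_continuous (W : set M) f x : open W -> W x -> smooth_on A W f ->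
  {for x, continuous f}.
Proof.
move=> Wo Wx /(_ x Wx)[Q [g [Qo Qx Qg fg]]].
have [[domo domP _ chartc _] _] := hA.
have [i ix] := domP x; have [h hC gh] := Qg i.
have fE y : (Q `&` W `&` Defs.dom A i) y -> f y = (h \o chart A i) y.
  by move=> [[Qy Wy] iy]; rewrite fg ?inE // gh.
have near_fE : \forall y \near x, (h \o chart A i) y = f y.
  apply: filterS (_ : nbhs x (Q `&` W `&` Defs.dom A i)); first by move=> y /fE.
  by apply: open_nbhs_nbhs; split=> //; do 2?apply: openI.
suff : f @ x --> f x by [].
rewrite (fE x) //; apply: cvg_trans (near_eq_cvg near_fE) _.
apply: continuous_comp; first exact: chartc.
by have [hc _] := hC 0%N; apply: hc; exists x.
Qed.

(** Distinct signs have distance 2, so a continuous one cannot jump. *)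
Lemma smooth_sign_locally_constant (W : set M) (s : M -> bool) x : open W -> W x ->
  smooth_on A W (fun y => (-1) ^+ s y) -> \forall y \near x, s y = s x.
Proof.
move=> Wo Wx /(smooth_on_continuous Wo Wx) sc.
have : \forall y \near x, `|(-1) ^+ s x - (-1) ^+ s y| < 1 :> R.
  by move/cvgrPdist_lt : sc; apply.
apply: filterS => y; case: (s x) (s y) => [] []; rewrite // ?expr1 ?expr0.
  by rewrite -opprD normrN ger0_norm ?addr_ge0 // gtrDl ltr10.
by rewrite opprK ger0_norm ?addr_ge0 // gtrDl ltr10.
Qed.

End Atlas.
End Smooth.

Lemma near_all_seq (T : topologicalType) (I : eqType) (s : seq I) (x : T) (P : I -> T -> Prop) :
  (forall i, i \in s -> \forall y \near x, P i y) ->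
  \forall y \near x, forall i, i \in s -> P i y.
Proof.
elim: s => [|i s IH] sP; first by apply: nearW.
have si : \forall y \near x, P i y by apply: sP; exact: mem_head.
have ss : \forall y \near x, forall j, j \in s -> P j y.
  by apply: IH => j js; apply: sP; rewrite inE js orbT.
by apply: filterS (filterI si ss) => y [Piy sy] j; rewrite inE => /predU1P[->|/sy].
Qed.

(** * The class of an orientable bundle vanishes *)

Section Orientable.
Variables (R : realType) (n : nat).
Variables (M : topologicalType) (V : normedModType R) (A : atlas M V).
Variable hM : smooth_manifold A.
Variable O : oriented_bundle2 n A.
Implicit Types u v : idx O.

(** Total in the indices, so that it defines a cochain at each point. *)
Definition osign u v (w : idx O) (x : M) : bool :=
  match pselect ((u < v)%O /\ (v < w)%O) with
  | left h => (bcoh O (proj1 h) (proj2 h) x).2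
  | right _ => false
  end.

Lemma osignE u v (w : idx O) (uv : (u < v)%O) (vw : (v < w)%O) x :
  osign u v w x = (bcoh O uv vw x).2.
Proof.
rewrite /osign; case: pselect => [h|h]; last by case: (h (conj uv vw)).
by rewrite (bool_irrelevance (proj1 h) uv) (bool_irrelevance (proj2 h) vw).
Qed.

(** The second component of the coherence condition of [O]. *)
Lemma osign_assoc u v (w t : idx O) x : (u < v)%O -> (v < w)%O -> (w < t)%O ->
  (O u `&` O v `&` O w `&` O t) x ->
  sgn R[i] (bobj O u v) (bobj O v w) (bobj O w t) =
  osign v w t x (+) (osign u w t x (+) (osign u v t x (+) osign u v w x)).
Proof.
move=> uv vw wt Ox; have uw := lt_trans uv vw; have vt := lt_trans vw wt.
rewrite (osignE uv vt) (osignE vw wt) (osignE uw wt) (osignE uv vw).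
have /(congr1 snd) /= := bcoh_assoc uv vw wt uw vt Ox.
move: (sgn _ _ _ _) (_.2) (_.2) (_.2) (_.2).
by do 5!case.
Qed.

Lemma osign_locally_constant u v (w : idx O) x : (u < v)%O -> (v < w)%O ->
  (O u `&` O v `&` O w) x -> \forall y \near x, osign u v w y = osign u v w x.
Proof.
move=> uv vw Ox; rewrite (osignE uv vw).
have cop a : open (O a) by have [Q Qo ->] := cset_open a; rewrite setIT.
have sm : smooth_on A (O u `&` O v `&` O w) (fun y => (-1) ^+ (bcoh O uv vw y).2 : R).
  by apply: (bcoh_smooth uv vw (p := fun f => (-1) ^+ f.2)); right.
have := smooth_sign_locally_constant _ _ Ox sm.
case: hM => hA _ _ _ /(_ hA) nearE.
apply: filterS (nearE _) => [y <-|]; first exact: osignE.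
by do 2?apply: openI.
Qed.

Definition osign_cochain (x : M) : cochain (idx O) 2 :=
  fun a => osign (a (inord 0)) (a (inord 1)) (a (inord 2)) x.

Lemma osign_coboundary x (s : seq (idx O)) : size s = 4 -> (forall u, u \in s -> O u x) ->
  seq_alt (sgn_cochain (forget O)) s = seq_delta (seq_alt (osign_cochain x)) s.
Proof.
move=> s4 sx; apply: (symmetric_ext_on (P := fun u => O u x)) s4 _ (sx).
- exact: symmetric_seq_alt.
- exact/symmetric_seq_delta/symmetric_seq_alt.
- move=> a ainc ax; rewrite (seq_alt_increasing (J := idx (forget O))) // seq_alt_coboundary //.
  rewrite /coboundary !big_ord_recl big_ord0 /osign_cochain /=.
  have liftE (k : 'I_4) j : (j < 3)%N -> lift k (inord j : 'I_3) = inord (bump k j).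
    move=> j4; apply: val_inj; rewrite /= !inordK //.
    by rewrite /bump; case: (k <= j)%N => /=; rewrite ?add1n ?add0n ?ltnS // leqW.
  rewrite !liftE //= /bump /= !add0n ?add1n addbF.
  have lt i j : (i < j < 4)%N -> (a (inord i) < a (inord j))%O.
    exact: (increasingE (E := forget O)).
  by apply: osign_assoc; rewrite ?lt.
- by apply: (common_comparable (U := forget O)); exists x => u /sx.
Qed.

(** The supports [K i] of a partition of unity are a locally finite closed shrinking of the
cover.  A small neighbourhood of [x] meets [K i] only if [x] lies in [K i], which leaves
finitely many indices, and on it all signs with such indices are constant.  If the
neighbourhoods of several points meet and each lies in the support assigned to its point,
then each of them meets all these supports. *)
Lemma adapted_refinement : exists (W : ordered_cover [set: M]) (h : idx W -> M)
    (rho : idx W -> idx O), refinement rho /\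
  forall (w w1 w2 w3 : idx W) p, W w p -> W w1 p -> W w2 p -> W w3 p ->
    (rho w1 < rho w2)%O -> (rho w2 < rho w3)%O ->
    osign (rho w1) (rho w2) (rho w3) p = osign (rho w1) (rho w2) (rho w3) (h w).
Proof.
have Oop a : open (O a) by have [Q Qo ->] := cset_open a; rewrite setIT.
have Ocov : open_cover (O : idx O -> set M) by split=> //; exact: cset_cover.
have [hA _ _ pou] := hM.
have [f [fsm f0 fO flf fsum]] := pou _ _ Ocov.
pose K i := closure [set x | f i x != 0].
have /choice[r rP] x : exists i, f i x != 0.
  apply: contrapT => /forallNP h; have := fsum x; rewrite fsbig1 => [/eqP|i _].
    by rewrite eq_sym oner_eq0.
  by apply/eqP/negPn/negP; exact: h.
have /choice[T TP] x : exists T : set M, [/\ open T, T x, T `<=` K (r x) &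
    forall i j k y y1 y2 y3, T y -> (T y1 /\ K i y1) -> (T y2 /\ K j y2) ->
      (T y3 /\ K k y3) -> (i < j)%O -> (j < k)%O -> osign i j k y = osign i j k x].
  have [N Nx /finite_seqP[s sE]] := flf x.
  have Ns i y : N y -> K i y -> i \in s.
    by move=> Ny Ky; suff : [set` s] i by []; rewrite -sE; exists y.
  have near1 : \forall y \near x, f (r x) y != 0.
    have fc : {for x, continuous (f (r x))}.
      by apply: (smooth_on_continuous hA openT) => //; exact: fsm.
    have nz : nbhs (f (r x) x) [set z : R | z != 0].
      by apply: open_nbhs_nbhs; split; [exact: open_neq|exact: rP].
    exact: (fc _ nz).
  (* This is where closedness of the supports is used. *)
  have near2 : \forall y \near x, forall i, i \in s -> K i y -> K i x.
    apply: near_all_seq => i _; have [Kx|nKx] := pselect (K i x); first exact: nearW.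
    have : nbhs x (~` K i).
      by apply: open_nbhs_nbhs; split=> //; exact/closed_openC/closed_closure.
    by apply: filterS => y nKy /nKy.
  have near3 : \forall y \near x, forall i, i \in s -> forall j, j \in s -> forall k, k \in s ->
      K i x -> K j x -> K k x -> (i < j)%O -> (j < k)%O -> osign i j k y = osign i j k x.
    apply: near_all_seq => i _; apply: near_all_seq => j _; apply: near_all_seq => k _.
    have [[Ki Kj Kk ij jk]|no] := pselect [/\ K i x, K j x, K k x, (i < j)%O & (j < k)%O].
      have := osign_locally_constant ij jk (conj (conj (fO _ _ Ki) (fO _ _ Kj)) (fO _ _ Kk)).
      by apply: filterS => y -> *.
    by apply: nearW => y *; case: no; split.
  have := filterI Nx (filterI near1 (filterI near2 near3)).
  set Q := (X in nbhs x X) => Qx; exists Q^°; split.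
  - exact: open_interior.
  - exact: Qx.
  - by move=> y /interior_subset[_ [fy _]]; exact: subset_closure.
  - move=> i j k y y1 y2 y3 /interior_subset[_ [_ [_ Qy]]].
    move=> [/interior_subset[N1 [_ [Q1 _]]] K1] [/interior_subset[N2 [_ [Q2 _]]] K2].
    move=> [/interior_subset[N3 [_ [Q3 _]]] K3].
    have [s1 s2 s3] := And3 (Ns _ _ N1 K1) (Ns _ _ N2 K2) (Ns _ _ N3 K3).
    exact: Qy s1 _ s2 _ s3 (Q1 _ s1 K1) (Q2 _ s2 K2) (Q3 _ s3 K3).
have Top x : exists2 Q, open Q & T x = Q `&` [set: M].
  by exists (T x); [case: (TP x)|rewrite setIT].
have Tcov : \bigcup_x T x = [set: M].
  by apply/seteqP; split=> // x _; exists x => //; case: (TP x).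
have [W [h hE]] := cover_exists Top Tcov.
have TK w p : W w p -> K (r (h w)) p by rewrite hE; case: (TP (h w)) => _ _ + _; apply.
exists W, h, (r \o h); split=> [w p /TK /fO //|w w1 w2 w3 p Wp W1 W2 W3 r12 r23].
have [_ _ _ Tw] := TP (h w); have Tp : T (h w) p by rewrite -hE.
by apply: (Tw _ _ _ p p p p) => //; split=> //; exact: TK.
Qed.

(** At a point [p] the signs of the coherence maps at [p] cobound the sign cocycle.  On the
adapted refinement these signs do not depend on [p], so they may be evaluated at the
point that belongs to the first index of the simplex. *)
Theorem orientable_zero_class : zero_class (sgn_cochain (forget O)).
Proof.
have [W [h [rho [rhoP osignP]]]] := adapted_refinement.
pose c (t : seq (idx W)) :=
  if t is w :: _ then seq_alt (osign_cochain (h w)) (map rho t) else false.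
apply: (same_class_intro (U := forget O) (rho := rho) (rho' := rho) (c := c)) => //.
move=> s s4 [p ps]; rewrite seq_alt_false addbF.
rewrite (@osign_coboundary p) ?size_map //; last first.
  by move=> u /mapP[w ws ->]; exact/rhoP/ps.
rewrite -(seq_delta_map rho (seq_alt (osign_cochain p))) !seq_delta_sum.
apply: eq_bigr => k _; set t := take k s ++ drop k.+1 s.
have ts w : w \in t -> W w p.
  by rewrite mem_cat => /orP[/mem_take|/mem_drop]; exact: ps.
case: t ts => [|w t] ts /=; first by rewrite seq_alt_size.
apply: seq_alt_eq => b binc bt.
have lt i j : (i < j < 3)%N -> (b (inord i) < b (inord j))%O.
  exact: (increasingE (E := forget O)).
have [l01 l12] := (lt 0%N 1%N isT, lt 1%N 2%N isT); rewrite /osign_cochain.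
have := bt (inord 0); have := bt (inord 1); have := bt (inord 2); rewrite -map_cons.
move=> /mapP[w3 w3t b3] /mapP[w2 w2t b2] /mapP[w1 w1t b1].
by rewrite b1 b2 b3 in l01 l12 *; apply: osignP => //; apply: ts; rewrite ?mem_head.
Qed.

End Orientable.

(** * A bundle with vanishing class is orientable *)

Section Pullback.
Variables (R : realType) (n : nat).
Variables (M : topologicalType) (V : normedModType R) (A : atlas M V) (S : set M).
Variable E : bundle (GL R n) A S.
Variables (M' : topologicalType) (V' : normedModType R) (A' : atlas M' V') (S' : set M').
Variable proj : M' -> M.
Hypothesis proj_smooth : forall (W : set M) (W' : set M') f,
  W' `<=` proj @^-1` W -> smooth_on A W f -> smooth_on A' W' (f \o proj).
Variables (U : ordered_cover S') (rho : idx U -> idx E).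
Hypothesis rho_homo : forall a b, (a <= b)%O -> (rho a <= rho b)%O.
Hypothesis rho_sub : forall a x, U a x -> E (rho a) (proj x).

Definition pull_obj (a b : idx U) : glob n := wobj E (rho a) (rho b).

Lemma pull_obj_prod (a b c : idx U) : (a < b)%O -> (b < c)%O ->
  prodo (B := GL R n) (pull_obj a b) (pull_obj b c) = pull_obj a c.
Proof. by move=> ab bc; apply: wobj_prod; apply: rho_homo; exact: ltW. Qed.

Definition pull_coh (a b c : idx U) (ab : (a < b)%O) (bc : (b < c)%O) (x : M') :
    @Defs.hom R (GL R n) (prodo (B := GL R n) (pull_obj a b) (pull_obj b c)) (pull_obj a c) :=
  wcoh (rho_homo (ltW ab)) (rho_homo (ltW bc)) (proj x).

Lemma pull_smooth (a b c : idx U) (ab : (a < b)%O) (bc : (b < c)%O) p :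
  coords p -> smooth_on A' (U a `&` U b `&` U c) (p \o pull_coh ab bc).
Proof.
move=> cp; rewrite /pull_coh.
have [/andP[h1 h2]|] := boolP ((rho a < rho b)%O && (rho b < rho c)%O).
  pose q := p \o conj_cast (wobj_lt h1) (wobj_lt h2) (wobj_lt (lt_trans h1 h2)).
  have cq : coords (B := GL R n) q by exact: coords_conj_cast.
  rewrite (_ : p \o _ = (q \o bcoh E h1 h2) \o proj); last first.
    apply: functional_extensionality_dep => x /=; congr (p _); exact: wcohE_lt.
  apply: proj_smooth (bcoh_smooth h1 h2 cq).
  by move=> x [[/rho_sub ? /rho_sub ?] /rho_sub ?].
rewrite !lt_neqAle !rho_homo ?ltW // !andbT negb_and !negbK => abc.
rewrite (_ : p \o _ = fun=> p (gcast R (wobj_prod (rho_homo (ltW ab)) (rho_homo (ltW bc))))).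
  exact: smooth_on_cst.
by apply: functional_extensionality_dep => x /=; rewrite wcohE_eq.
Qed.

Lemma pull_iso (a b c : idx U) (ab : (a < b)%O) (bc : (b < c)%O) x :
  (U a `&` U b `&` U c) x -> is_iso (pull_coh ab bc x).
Proof. by move=> [[/rho_sub ? /rho_sub ?] /rho_sub ?]; apply: wcoh_iso. Qed.

Lemma pull_assoc (a b c d : idx U) (ab : (a < b)%O) (bc : (b < c)%O) (cd : (c < d)%O)
    (ac : (a < c)%O) (bd : (b < d)%O) x :
  (U a `&` U b `&` U c `&` U d) x ->
  Defs.comp (pull_coh ab bd x)
    (prodm (Defs.idm (B := GL R n) (pull_obj a b)) (pull_coh bc cd x)) =
  Defs.comp (Defs.comp (pull_coh ac cd x)
      (prodm (pull_coh ab bc x) (Defs.idm (B := GL R n) (pull_obj c d))))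
    (Defs.assoc (B := GL R n) (pull_obj a b) (pull_obj b c) (pull_obj c d)).
Proof.
by move=> [[[/rho_sub ? /rho_sub ?] /rho_sub ?] /rho_sub ?]; apply: wcoh_assoc.
Qed.

Definition pull_bundle : bundle (GL R n) A' S' :=
  @Bundle R (GL R n) M' V' A' S' U pull_obj pull_obj_prod pull_coh
    pull_smooth pull_iso pull_assoc.

End Pullback.

Section Orient.
Variables (R : realType) (n : nat).
Variables (M : topologicalType) (V : normedModType R) (A : atlas M V).
Variables (G : bundle2 n A) (tau : idx G -> idx G -> idx G -> bool).
Hypothesis tauP : forall a b c d x, (a < b)%O -> (b < c)%O -> (c < d)%O ->
  (G a `&` G b `&` G c `&` G d) x ->
  sgn R[i] (bobj G a b) (bobj G b c) (bobj G c d) =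
  tau b c d (+) (tau a c d (+) (tau a b d (+) tau a b c)).

Definition orient_coh (a b c : idx G) (ab : (a < b)%O) (bc : (b < c)%O) (x : M) :
    @Defs.hom R (OGL R n) (prodo (B := OGL R n) (bobj G a b) (bobj G b c)) (bobj G a c) :=
  (bcoh G ab bc x, tau a b c).

Lemma orient_smooth (a b c : idx G) (ab : (a < b)%O) (bc : (b < c)%O) p :
  coords p -> smooth_on A (G a `&` G b `&` G c) (p \o orient_coh ab bc).
Proof.
move=> [[q cq ->]|->]; last exact: smooth_on_cst.
exact: (bcoh_smooth ab bc cq).
Qed.

Lemma orient_iso (a b c : idx G) (ab : (a < b)%O) (bc : (b < c)%O) x :
  (G a `&` G b `&` G c) x -> is_iso (orient_coh ab bc x).
Proof.
move=> /(bcoh_iso ab bc)[g gf fg]; exists (g, tau a b c).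
  by rewrite /= addbb; congr (_, _).
by rewrite /= addbb; congr (_, _).
Qed.

Lemma orient_assoc (a b c d : idx G) (ab : (a < b)%O) (bc : (b < c)%O) (cd : (c < d)%O)
    (ac : (a < c)%O) (bd : (b < d)%O) x :
  (G a `&` G b `&` G c `&` G d) x ->
  Defs.comp (orient_coh ab bd x)
    (prodm (Defs.idm (B := OGL R n) (bobj G a b)) (orient_coh bc cd x)) =
  Defs.comp (Defs.comp (orient_coh ac cd x)
      (prodm (orient_coh ab bc x) (Defs.idm (B := OGL R n) (bobj G c d))))
    (Defs.assoc (B := OGL R n) (bobj G a b) (bobj G b c) (bobj G c d)).
Proof.
move=> Gx; rewrite /=; congr (_, _); first exact: (bcoh_assoc ab bc cd ac bd Gx).
rewrite (tauP ab bc cd Gx) addbF.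
by move: (tau b c d) (tau a c d) (tau a b d) (tau a b c); do 4!case.
Qed.

(** A cochain that cobounds the sign cocycle of [G] supplies the signs that lift the
coherence maps of [G] to [OGL]. *)
Definition orient : oriented_bundle2 n A :=
  @Bundle R (OGL R n) M V A setT G (bobj G) (@bobj_prod _ _ _ _ _ _ G) orient_coh
    orient_smooth orient_iso orient_assoc.

End Orient.

Section WeakSign.
Variables (R : realType) (n : nat).
Variables (M : topologicalType) (V : normedModType R) (A : atlas M V).
Variable E : bundle2 n A.

(** Where two neighbours agree the left side vanishes as an alternating cochain, and the
right side because an associator with a unit factor is an identity. *)
Lemma seq_alt_sgn_weak (u v w t : idx E) : (u <= v)%O -> (v <= w)%O -> (w <= t)%O ->
  seq_alt (sgn_cochain E) [:: u; v; w; t] =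
  sgn R[i] (wobj E u v) (wobj E v w) (wobj E w t).
Proof.
move=> uv vw wt.
have [/and3P[uv' vw' wt']|] := boolP [&& (u < v)%O, (v < w)%O & (w < t)%O].
  pose b (i : 'I_4) := nth u [:: u; v; w; t] i.
  have bE : [seq b i | i <- enum 'I_4] = [:: u; v; w; t].
    by rewrite -[RHS]/(map (nth u [:: u; v; w; t]) (iota 0 4)) -val_enum_ord -map_comp.
  rewrite -bE seq_alt_increasing; last by rewrite increasing_sorted bE /= uv' vw' wt'.
  have bK k : (k < 4)%N -> b (inord k) = nth u [:: u; v; w; t] k.
    by move=> k4; rewrite /b inordK.
  have [b0 b1] := (bK 0%N isT, bK 1%N isT); have [b2 b3] := (bK 2%N isT, bK 3%N isT).
  rewrite /sgn_cochain b0 b1 b2 b3 (wobj_lt uv') (wobj_lt vw') (wobj_lt wt').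
  reflexivity.
rewrite !lt_neqAle uv vw wt !andbT !negb_and !negbK => uvwt.
rewrite (proj2 (symmetric_seq_alt _)); last first.
  by case/or3P: uvwt => /eqP -> /=; rewrite !inE eqxx ?orbT ?andbF.
by rewrite sgn_unit //; case/or3P: uvwt => /eqP ->; rewrite wobj_unit;
  [constructor 1|constructor 2|constructor 3].
Qed.

End WeakSign.

Lemma nonempty_idx_eq (I T : Type) (U : I -> set T) (a b : nonempty_idx U) :
  sval a = sval b -> a = b.
Proof.
case: a b => [a pa] [b pb] /= e; case: _ / e in pb *.
by rewrite (Prop_irrelevance pa pb).
Qed.

Lemma inj_surj_bijective (T U : Type) (f : T -> U) :
  injective f -> (forall y, exists x, f x = y) -> bijective f.
Proof.
by move=> f_inj /choice[g gP]; exists g => // x; apply: f_inj; rewrite gP.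
Qed.

Section ZeroClass.
Variables (R : realType) (n : nat).
Variables (M : topologicalType) (V : normedModType R) (A : atlas M V).
Variable E : bundle2 n A.

(** The indices of the old cover and of the refinement are put into one set, ordered
along the map [rho] to the indices of [E]; the refinement [GU] and the cover [HU] of the
cylinder both inherit their order from it. *)
Theorem zero_class_orientable : zero_class (sgn_cochain E) -> orientable E.
Proof.
move=> /same_class_elim[W [r [r' [c [rP _ _ cE]]]]].
have [R0 R0P] := total_order_exists (idx E + idx W)%type.
pose rho (k : idx E + idx W) := match k with inl a => a | inr w => r w end.
pose R1 (w w' : idx W) := R0 (inr w) (inr w').
have R1P : wochoice.total_order R1.
  case: R0P => [[[rr rt] ra] rtot]; split; [split; [split|]|].
  - by move=> w; exact: rr.
  - by move=> w1 w2 w3; exact: rt.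
  - by move=> w1 w2 /ra[].
  - by move=> w1 w2; exact: rtot.
have Ecomp u v x : E u x -> E v x -> (u >=< v)%O.
  move=> Eu Ev; apply: (@common_comparable _ _ E [:: u; v]); rewrite ?inE ?eqxx ?orbT //.
  by exists x => w; rewrite !inE => /orP[] /eqP ->.
have Wtot w w' : W w `&` W w' !=set0 -> (r w >=< r w')%O.
  by move=> [x [/rP Ew /rP Ew']]; exact: Ecomp Ew Ew'.
pose GU : ordered_cover [set: M] :=
  lexi_cover R1P (@cset_open _ _ W) (@cset_cover _ _ W) Wtot.
have G_homo (a b : idx GU) : (a <= b)%O -> (r a <= r b)%O by exact: lexi_homo.
have id_smooth (Q Q' : set M) f : Q' `<=` id @^-1` Q ->
    smooth_on A Q f -> smooth_on A Q' (f \o id).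
  by move=> QQ'; exact: smooth_on_subset.
pose G : bundle2 n A := pull_bundle id_smooth G_homo (rP : forall a x, GU a x -> _).
pose tau (a b d : idx G) := c [:: a; b; d].
have tauP (w1 w2 w3 w4 : idx G) x : (w1 < w2)%O -> (w2 < w3)%O -> (w3 < w4)%O ->
    (G w1 `&` G w2 `&` G w3 `&` G w4) x ->
    sgn R[i] (bobj G w1 w2) (bobj G w2 w3) (bobj G w3 w4) =
    tau w2 w3 w4 (+) (tau w1 w3 w4 (+) (tau w1 w2 w4 (+) tau w1 w2 w3)).
  move=> w12 w23 w34 [[[Wx1 Wx2] Wx3] Wx4].
  have scom : common (U := W) [:: w1; w2; w3; w4].
    by exists x => w; rewrite !inE => /or4P[] /eqP ->.
  have := cE ([:: w1; w2; w3; w4] : seq (idx W)) erefl scom.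
  rewrite seq_alt_false addbF /= addbF => <-.
  by rewrite seq_alt_sgn_weak // G_homo // ltW.
exists (orient tauP).
(* The slice at 0 only meets the members over the old cover, the slice at 1 only those
   over the refinement. *)
pose CH (k : idx E + idx W) : set (M * R) := match k with
  | inl a => [set p | E a p.1 /\ 0 <= p.2 < 1]
  | inr w => [set p | W w p.1 /\ 0 < p.2 <= 1]
  end.
have CHop k : exists2 Q, open Q & CH k = Q `&` cylinder R M.
  have fsto (Q : set M) : open Q -> open ((fst : M * R -> M) @^-1` Q).
    by move=> Qo; apply: open_comp => // p _; exact: cvg_fst.
  have sndo (Q : set R) : open Q -> open ((snd : M * R -> R) @^-1` Q).
    by move=> Qo; apply: open_comp => // p _; exact: cvg_snd.
  case: k => [a|w] /=.
    have [Q Qo EQ] := cset_open a.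
    exists (fst @^-1` Q `&` snd @^-1` [set t : R | t < 1]).
      by apply: openI; [exact: fsto|apply: sndo; exact: open_lt].
    apply/seteqP; split=> -[x t] /=; rewrite EQ /cylinder /= in_itv /=.
      by move=> [[Qx _] /andP[t0 t1]]; rewrite t0 (ltW t1).
    by move=> [[Qx t1] [_ /andP[t0 _]]]; rewrite t0 t1.
  have [Q Qo WQ] := cset_open w.
  exists (fst @^-1` Q `&` snd @^-1` [set t : R | 0 < t]).
    by apply: openI; [exact: fsto|apply: sndo; exact: open_gt].
  apply/seteqP; split=> -[x t] /=; rewrite WQ /cylinder /= in_itv /=.
    by move=> [[Qx _] /andP[t0 t1]]; rewrite t1 (ltW t0).
  by move=> [[Qx t0] [_ /andP[_ t1]]]; rewrite t0 t1.
have CHcov : \bigcup_k CH k = cylinder R M.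
  apply/seteqP; split=> [[x t] [[a|w] _ /= [_ /andP[t0 t1]]]|[x t]];
    rewrite /cylinder /= in_itv /= ?t0 ?t1 ?(ltW t0) ?(ltW t1) //.
  move=> [_ /andP[t0 t1]]; have [t1'|t1'] := ltP t 1.
    have : (\bigcup_(a in setT) E a) x by rewrite cset_cover.
    by move=> [a _ Ex]; exists (inl a) => //=; rewrite t0 t1'.
  have : (\bigcup_(w in setT) W w) x by rewrite cset_cover.
  by move=> [w _ Wx]; exists (inr w) => //=; rewrite t1 (lt_le_trans ltr01 t1').
have CHsub k p : CH k p -> E (rho k) p.1.
  by case: k => [a|w] /= [] // /rP.
have CHtot k l : CH k `&` CH l !=set0 -> (rho k >=< rho l)%O.
  by move=> [p [/CHsub Ek /CHsub El]]; exact: Ecomp Ek El.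
pose HU : ordered_cover (cylinder R M) := lexi_cover R0P CHop CHcov CHtot.
have H_homo (a b : idx HU) : (a <= b)%O -> (rho a <= rho b)%O by exact: lexi_homo.
have cyl_smooth (Q : set M) (Q' : set (M * R)) f : Q' `<=` fst @^-1` Q ->
    smooth_on A Q f -> smooth_on (cyl_atlas A) Q' (f \o fst).
  exact: smooth_on_cyl.
pose H := pull_bundle cyl_smooth H_homo (CHsub : forall a x, HU a x -> _).
have Hconst t : constant_near H t.
  by move=> a b d ab bd x _; apply: (@nearW _ (nbhs ((x, t) : (M * R)%type))) => p _.
have H_ltl (a b : idx E) : ((inl a : idx HU) < inl b)%O = (a < b)%O.
  rewrite lexi_ltE /lexi_le /= (inj_eq (@inl_inj _ _)).
  case: (eqVneq b a) => [->|ba] /=; first by rewrite ltxx.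
  by rewrite orbF.
have H_ltr (a b : idx W) : ((inr a : idx HU) < inr b)%O = ((a : idx GU) < b)%O.
  by rewrite !lexi_ltE /lexi_le /= (inj_eq (@inr_inj _ _)).
have slice0 a : slice (H (inl a)) 0 = E a.
  by apply/seteqP; split=> x; rewrite /slice /= lexx ltr01 => // -[].
have slice1 w : slice (H (inr w)) 1 = W w.
  by apply/seteqP; split=> x; rewrite /slice /= lexx ltr01 => // -[].
exists H; split; last exact: (Hconst 1); last exact: (Hconst 0).
- have ne (a : nonempty_idx E) : slice (H (inl (sval a))) 0 !=set0.
    by rewrite slice0; exact: (svalP a).
  pose f (a : nonempty_idx E) : nonempty_idx (fun k => slice (H k) 0) :=
    exist (fun k => slice (H k) 0 !=set0) (inl (sval a)) (ne a).
  exists f; split.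
  + apply: inj_surj_bijective => [a b /(congr1 sval) /= [ab]|[[a|w] p]].
    * exact: nonempty_idx_eq.
    * have pa : E a !=set0 by rewrite -slice0.
      by exists (exist (fun a => E a !=set0) a pa); apply: nonempty_idx_eq.
    * by exfalso; case: p => x; rewrite /slice /= ltxx => -[].
  + by move=> a b; exact: (H_ltl (sval a) (sval b)).
  + by move=> a; exact: (slice0 (sval a)).
  + by move=> a b ab; exact: wobj_lt.
  + by move=> *; exact: arrow_wcoh.
- have ne (w : nonempty_idx G) : slice (H (inr (sval w))) 1 !=set0.
    by rewrite slice1; exact: (svalP w).
  pose f (w : nonempty_idx G) : nonempty_idx (fun k => slice (H k) 1) :=
    exist (fun k => slice (H k) 1 !=set0) (inr (sval w)) (ne w).
  exists f; split.
  + apply: inj_surj_bijective => [a b /(congr1 sval) /= [ab]|[[a|w] p]].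
    * exact: nonempty_idx_eq.
    * by exfalso; case: p => x; rewrite /slice /= ltxx andbF => -[].
    * have pw : G w !=set0 by rewrite -[G w]slice1.
      by exists (exist (fun w => G w !=set0) w pw); apply: nonempty_idx_eq.
  + by move=> w w'; exact: (H_ltr (sval w) (sval w')).
  + by move=> w; exact: (slice1 (sval w)).
  + by move=> w1 w2 _.
  + move=> w1 w2 w3 w12 w23 w12' w23' x Wx.
    have irr u v w (h1 h1' : (u <= v)%O) (h2 h2' : (v <= w)%O) :
        arrow (B := GL R n) (X := glprod (wobj E u v) (wobj E v w)) (Y := wobj E u w)
          (wcoh h1 h2 x) =
        arrow (B := GL R n) (X := glprod (wobj E u v) (wobj E v w)) (Y := wobj E u w)
          (wcoh h1' h2' x).
      by rewrite (bool_irrelevance h1 h1') (bool_irrelevance h2 h2').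
    have := irr (r (sval w1)) (r (sval w2)) (r (sval w3))
      (H_homo (inr (sval w1)) (inr (sval w2)) (ltW w12')) (G_homo _ _ (ltW w12))
      (H_homo (inr (sval w2)) (inr (sval w3)) (ltW w23')) (G_homo _ _ (ltW w23)).
    exact.
Qed.

End ZeroClass.

Theorem lemma2p19 (R : realType) (M : topologicalType) (V : normedModType R)
    (A : atlas M V) (hM : smooth_manifold A) (n : nat) :
  (forall E : bundle2 n A, cocycle (sgn_cochain E)) /\
  (forall E0 E1 : bundle2 n A, equivalent E0 E1 ->
    same_class (sgn_cochain E0) (sgn_cochain E1)) /\
  (forall E : bundle2 n A, zero_class (sgn_cochain E) <-> orientable E).
Proof.
split; first by move=> E; exact: (@sign_cocycle _ _ _ _ _ _ E).
split; first exact: equivalent_same_class.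
move=> E; split; first exact: zero_class_orientable.
move=> [Q EQ]; apply: (same_class_zero _ (equivalent_same_class EQ)).
  exact: (@sign_cocycle _ _ _ _ _ _ (forget Q)).
exact: orientable_zero_class.
Qed.
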